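(* Let $\{\mathbb{X}_n\}_{n\in\mathbb{N}}$ be a sequence of non-trivial normed linear spaces over $\mathbb{K}$, let $p\in(1,\infty)\setminus\{2\}$, and let $x=\{x_n\}_{n\in\mathbb{N}}\in\bigoplus_p\mathbb{X}_n$. Then: (1) If $x$ is left-symmetric, then either there exists $n_0\in\mathbb{N}$ such that $x_n=0$ for $n\neq n_0$ and $x_{n_0}$ is a left-symmetric point of $\mathbb{X}_{n_0}$, or there exist $m,k\in\mathbb{N}$ such that $x_n=0$ if $n\neq m,k$, $\|x_m\|=\|x_k\|$, and $x_m,x_k$ are smooth $p$-left s.i.p. symmetric points of $\mathbb{X}_m,\mathbb{X}_k$ respectively. (2) If $x$ is right-symmetric, then either there exists $n_0\in\mathbb{N}$ such that $x_n=0$ for $n\neq n_0$ and $x_{n_0}$ is a right-symmetric point of $\mathbb{X}_{n_0}$, or there exist $m,k\in\mathbb{N}$ such that $x_n=0$ if $n\neq m,k$, $\|x_m\|=\|x_k\|$, and $x_m,x_k$ are $p$-right s.i.p. symmetric points of $\mathbb{X}_m,\mathbb{X}_k$ respectively.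
   Context: $\mathbb{K}=\mathbb{R}$ or $\mathbb{C}$; non-trivial means of dimension more than $0$. For $1\le p<\infty$, $\bigoplus_p\mathbb{X}_n$ is the space of sequences $\{x_n\}$ with $x_n\in\mathbb{X}_n$ and $\sum_n\|x_n\|^p<\infty$, with norm $\|\{x_n\}\|_p=(\sum_n\|x_n\|^p)^{1/p}$. In a normed space $\mathbb{X}$, $x\perp_By$ means $\|x+\lambda y\|\ge\|x\|$ for every scalar $\lambda\in\mathbb{K}$. A point $x\in\mathbb{X}$ is left-symmetric if $x\perp_By\Rightarrow y\perp_Bx$ for every $y\in\mathbb{X}$, and right-symmetric if $y\perp_Bx\Rightarrow x\perp_By$ for every $y\in\mathbb{X}$. A non-zero $x\in\mathbb{X}$ is smooth if there is exactly one $f\in\mathbb{X}^*$ with $\|f\|=1$ and $f(x)=\|x\|$. A semi-inner product (s.i.p.) on a normed space $\mathbb{X}$ is a map $[\cdot,\cdot]:\mathbb{X}\times\mathbb{X}\to\mathbb{K}$ with, for $x,y,z\in\mathbb{X}$, $\lambda\in\mathbb{K}$: $[x,x]=\|x\|^2$; $[x,y]+\lambda[x,z]=[x,y+\lambda z]$; $[\lambda x,y]=\overline{\lambda}[x,y]$; $|[x,y]|^2\le[x,x][y,y]$. For $1<p<\infty$, a point $x\in\mathbb{X}$ is $p$-left s.i.p. symmetric if for every non-zero $y\in\mathbb{X}$ and every s.i.p. $[\cdot,\cdot]$ on $\mathbb{X}$ there is an s.i.p. $[\cdot,\cdot]'$ on $\mathbb{X}$ with $[y,x]'=\left|\frac{[x,y]}{\|x\|\|y\|}\right|^{p-2}\overline{[x,y]}$;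 it is $p$-right s.i.p. symmetric if for every non-zero $y\in\mathbb{X}$ and every s.i.p. $[\cdot,\cdot]$ there is an s.i.p. $[\cdot,\cdot]'$ with $[y,x]=\left|\frac{[x,y]'}{\|x\|\|y\|}\right|^{p-2}\overline{[x,y]'}$. The right-hand sides are read as $0$ when $[x,y]=0$ (resp. $[x,y]'=0$). *)

(* Defs.v *)
From HB Require Import structures.
From mathcomp Require Import all_boot all_order all_algebra.
From mathcomp Require Import all_classical all_reals all_analysis.
From mathcomp Require Import complex.

Set Implicit Arguments.
Unset Strict Implicit.
Unset Printing Implicit Defensive.

Import Order.TTheory GRing.Theory Num.Theory.
Import numFieldNormedType.Exports.

Local Open Scope classical_set_scope.
Local Open Scope ring_scope.

Variant scalars := RealScalars | ComplexScalars.

Section Scalars.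
Variable R : realType.

Definition scalarK (k : scalars) : numFieldType :=
  match k with RealScalars => R | ComplexScalars => complex R end.

Definition conjK (k : scalars) : scalarK k -> scalarK k :=
  match k with RealScalars => id | ComplexScalars => @conjc R end.

Definition embK (k : scalars) : R -> scalarK k :=
  match k with
  | RealScalars => id
  | ComplexScalars => fun r => (Complex r 0 : complex R)
  end.

Definition reK (k : scalars) : scalarK k -> R :=
  match k with RealScalars => id | ComplexScalars => @complex.Re R end.

Variable k : scalars.
Implicit Types (r s : R) (z w : scalarK k).

Lemma embKK : cancel (@embK k) (@reK k).
Proof. by case: k. Qed.

Lemma reKK z : 0 <= z -> embK k (reK z) = z.
Proof.
case: k z => //= -[a b]; rewrite lecE /= => /andP[/eqP -> _].
by [].
Qed.

Lemma reK_le z w : z <= w -> reK z <= reK w.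
Proof. by case: k z w => //= -[a b] [c d]; rewrite lecE /= => /andP[]. Qed.

Lemma embK_le r s : r <= s -> embK k r <= embK k s.
Proof. by case: k => //= rs; rewrite lecE /= eqxx. Qed.

Lemma embKD r s : embK k (r + s) = embK k r + embK k s.
Proof. by case: k => //=; rewrite -[LHS]/(real_complex _ _) rmorphD. Qed.

Lemma embKM r s : embK k (r * s) = embK k r * embK k s.
Proof. by case: k => //=; rewrite -[LHS]/(real_complex _ _) rmorphM. Qed.

Lemma embK0 : embK k 0 = 0.
Proof. by case: k. Qed.

(* The norm of a normedModType over K takes its values in K; [nrm] is the same
   number as an element of R. *)
Definition nrm (V : normedModType (scalarK k)) (v : V) : R := reK `|v|.

Lemma embK_nrm (V : normedModType (scalarK k)) (v : V) :
  embK k (nrm v) = `|v|.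
Proof. exact: reKK. Qed.

Lemma nrm_ge0 (V : normedModType (scalarK k)) (v : V) : 0 <= nrm v.
Proof.
by rewrite -[leLHS]embKK embK0; exact: reK_le.
Qed.

Lemma ler_nrmD (V : normedModType (scalarK k)) (v w : V) :
  nrm (v + w) <= nrm v + nrm w.
Proof.
rewrite -[leRHS]embKK embKD !embK_nrm; apply: reK_le; exact: ler_normD.
Qed.

Lemma nrmZ (V : normedModType (scalarK k)) (l : scalarK k) (v : V) :
  nrm (l *: v) = reK `|l| * nrm v.
Proof. by rewrite -[RHS]embKK embKM embK_nrm reKK// /nrm normrZ. Qed.

Lemma nrm0 (V : normedModType (scalarK k)) : nrm (0 : V) = 0.
Proof. by rewrite /nrm normr0 -[in RHS](embKK 0) embK0. Qed.

Lemma nrmN (V : normedModType (scalarK k)) (v : V) : nrm (- v) = nrm v.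
Proof. by rewrite /nrm normrN. Qed.

Lemma nrm0_eq0 (V : normedModType (scalarK k)) (v : V) : nrm v = 0 -> v = 0.
Proof. by move=> v0; apply/normr0_eq0; rewrite -embK_nrm v0 embK0. Qed.

End Scalars.

(* The l^p direct sum. The exponent bound 1 <= p is a parameter of the type
   because the triangle inequality, hence the normedModType instance, needs
   it. *)
Section LpSum.
Variables (R : realType) (k : scalars).
Local Notation K := (scalarK R k).
Variables (X : nat -> normedModType K) (p : R).

Definition lp_series (x : forall n, X n) : \bar R :=
  (\sum_(0 <= n <oo) (nrm (x n) `^ p)%:E)%E.

Record lp_sum (hp : 1 <= p) := LpSum {
  lp_coord :> forall n, X n;
  lp_coordP : (lp_series lp_coord < +oo)%E }.

Hypothesis hp : 1 <= p.
Local Notation lp := (lp_sum hp).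

HB.instance Definition _ := gen_eqMixin lp.
HB.instance Definition _ := gen_choiceMixin lp.

Lemma lp_sumP (x y : lp) : (forall n, x n = y n) -> x = y.
Proof.
case: x y => [x xP] [y yP] /= xy.
have /= e : x = y by apply: functional_extensionality_dep.
by case: y / e yP xy => yP _; rewrite (Prop_irrelevance xP yP).
Qed.

Definition lp_norm (x : forall n, X n) : R := fine (lp_series x) `^ p^-1.

Let p0 : 0 < p. Proof. exact: lt_le_trans hp. Qed.

Lemma lp_series_ge0 x : (0 <= lp_series x)%E.
Proof. by apply: nneseries_ge0 => n _ _; rewrite lee_fin powR_ge0. Qed.

Lemma lp_norm_ge0 x : 0 <= lp_norm x.
Proof. exact: powR_ge0. Qed.

Let N (f : nat -> R) : \bar R := Lnorm counting p%:E (EFin \o f).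

Let NE f : N f = ((\sum_(0 <= n <oo) (`|f n| `^ p)%:E) `^ p^-1)%E.
Proof.
rewrite /N Lnorm_counting//.
Qed.

Let N_lp x : N (fun n => nrm (x n)) = (lp_series x `^ p^-1)%E.
Proof.
rewrite NE; congr (_ `^ _)%E; apply: eq_eseriesr => n _.
by rewrite ger0_norm ?nrm_ge0.
Qed.

Lemma lp_norm_EFin x :
  (lp_series x < +oo)%E -> (lp_norm x)%:E = (lp_series x `^ p^-1)%E.
Proof.
move=> xoo; have xfin : lp_series x \is a fin_num.
  by rewrite ge0_fin_numE// lp_series_ge0.
by rewrite /lp_norm -poweR_EFin fineK.
Qed.

Let lp_minkowski x y : (lp_series (fun n => x n + y n)%R `^ p^-1 <=
  lp_series x `^ p^-1 + lp_series y `^ p^-1)%E.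
Proof.
rewrite -!N_lp.
apply: (@le_trans _ _
    (N ((fun n => nrm (x n)) \+ (fun n => nrm (y n))))%R); last first.
  by rewrite /N; apply: minkowski_EFin.
rewrite !NE gt0_ler_poweR ?invr_ge0 ?(ltW p0)//.
- by rewrite in_itv/= leey andbT nneseries_ge0// => n _ _; rewrite lee_fin powR_ge0.
- by rewrite in_itv/= leey andbT nneseries_ge0// => n _ _; rewrite lee_fin powR_ge0.
apply: lee_nneseries => n _; first by rewrite lee_fin powR_ge0.
rewrite lee_fin ge0_ler_powR ?nnegrE ?(ltW p0)//.
rewrite !ger0_norm ?addr_ge0 ?nrm_ge0//; exact: ler_nrmD.
Qed.

Let lp_seriesK x : ((lp_series x `^ p^-1) `^ p = lp_series x)%E.
Proof. by rewrite -poweRrM mulVf ?gt_eqF// poweRe1// lp_series_ge0. Qed.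

Lemma lp_series_root_lty x : (lp_series x < +oo)%E ->
  (lp_series x `^ p^-1 < +oo)%E.
Proof. by move=> xoo; rewrite poweR_lty. Qed.

Lemma lp_addP (x y : lp) : (lp_series (fun n => x n + y n)%R < +oo)%E.
Proof.
rewrite -lp_seriesK poweR_lty//; apply: le_lt_trans (lp_minkowski x y) _.
by rewrite lte_add_pinfty// lp_series_root_lty// lp_coordP.
Qed.

Lemma lp_seriesZ (l : K) (x : forall n, X n) :
  lp_series (fun n => l *: x n) = ((reK `|l| `^ p)%:E * lp_series x)%E.
Proof.
rewrite /lp_series -nneseriesZl; last by move=> n _; rewrite lee_fin powR_ge0.
by apply: eq_eseriesr => n _; rewrite nrmZ powRM ?EFinM ?nrm_ge0//.
Qed.

Lemma lp_scaleP (l : K) (x : lp) : (lp_series (fun n => l *: x n)%R < +oo)%E.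
Proof.
rewrite lp_seriesZ lte_mul_pinfty ?lee_fin ?powR_ge0//; exact: lp_coordP.
Qed.

Lemma lp_oppP (x : lp) : (lp_series (fun n => - x n)%R < +oo)%E.
Proof.
suff -> : lp_series (fun n => - x n) = lp_series x by exact: lp_coordP.
by apply: eq_eseriesr => n _; rewrite nrmN.
Qed.

Lemma lp_series0 : lp_series (fun n => 0 : X n) = 0%E.
Proof. by apply: eseries0 => n _ _; rewrite nrm0 powR0 ?gt_eqF. Qed.

Lemma lp_zeroP : (lp_series (fun n => 0 : X n)%R < +oo)%E.
Proof. by rewrite lp_series0. Qed.

Definition lp_zero : lp := LpSum hp lp_zeroP.
Definition lp_opp (x : lp) : lp := LpSum hp (lp_oppP x).
Definition lp_add (x y : lp) : lp := LpSum hp (lp_addP x y).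
Definition lp_scale (l : K) (x : lp) : lp := LpSum hp (lp_scaleP l x).

Let lp_addA : associative lp_add.
Proof. by move=> x y z; apply: lp_sumP => n /=; rewrite addrA. Qed.
Let lp_addC : commutative lp_add.
Proof. by move=> x y; apply: lp_sumP => n /=; rewrite addrC. Qed.
Let lp_add0 : left_id lp_zero lp_add.
Proof. by move=> x; apply: lp_sumP => n /=; rewrite add0r. Qed.
Let lp_addN : left_inverse lp_zero lp_opp lp_add.
Proof. by move=> x; apply: lp_sumP => n /=; rewrite addNr. Qed.

HB.instance Definition _ :=
  GRing.isZmodule.Build lp lp_addA lp_addC lp_add0 lp_addN.

Let lp_scaleA (a b : K) (x : lp) :
  lp_scale a (lp_scale b x) = lp_scale (a * b) x.
Proof. by apply: lp_sumP => n /=; rewrite scalerA. Qed.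
Let lp_scale1 : left_id 1 lp_scale.
Proof. by move=> x; apply: lp_sumP => n /=; rewrite scale1r. Qed.
Let lp_scaleDr : right_distributive lp_scale +%R.
Proof. by move=> a x y; apply: lp_sumP => n /=; rewrite scalerDr. Qed.
Let lp_scaleDl (x : lp) : {morph lp_scale^~ x : a b / a + b}.
Proof. by move=> a b; apply: lp_sumP => n /=; rewrite scalerDl. Qed.

HB.instance Definition _ := GRing.Zmodule_isLmodule.Build K lp
  lp_scaleA lp_scale1 lp_scaleDr lp_scaleDl.

Definition lp_normK (x : lp) : K := embK k (lp_norm x).

Let lp_normD (x y : lp) : lp_normK (x + y) <= lp_normK x + lp_normK y.
Proof.
rewrite /lp_normK -embKD; apply: embK_le.
have := lp_minkowski x y.
rewrite -(lp_norm_EFin (lp_coordP x)) -(lp_norm_EFin (lp_coordP y)).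
by rewrite -(lp_norm_EFin (lp_addP x y)) -EFinD lee_fin.
Qed.

Let lp_normZ (l : K) (x : lp) : lp_normK (l *: x) = `|l| * lp_normK x.
Proof.
rewrite /lp_normK -[in RHS](@reKK _ k `|l|)// -embKM; congr embK.
have l0 : 0 <= reK `|l| by rewrite -[leLHS](embKK k) embK0; exact: reK_le.
rewrite {1}/lp_norm lp_seriesZ fineM//; last first.
  by rewrite ge0_fin_numE ?lp_series_ge0// lp_coordP.
rewrite powRM ?powR_ge0 ?fine_ge0 ?lp_series_ge0//= -powRrM.
by rewrite divff ?gt_eqF// powRr1.
Qed.

Let lp_norm0 (x : lp) : lp_normK x = 0 -> x = 0.
Proof.
move=> /(congr1 (@reK R k)); rewrite embKK -(embK0 R k) embKK => /eqP.
rewrite powR_eq0 => /andP[/eqP x0 _]; apply: lp_sumP => n.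
have {}x0 : lp_series x = 0%E.
  by rewrite -[LHS]fineK ?x0// ge0_fin_numE ?lp_series_ge0// lp_coordP.
have : ((nrm (x n) `^ p)%:E <= lp_series x)%E.
  have t0 i : (0 <= (nrm (x i) `^ p)%:E)%E by rewrite lee_fin powR_ge0.
  apply: le_trans (nneseries_lim_ge n.+1 (fun i _ _ => t0 i)).
  by rewrite big_nat_recr//= leeDr// sume_ge0.
rewrite x0 lee_fin => xn0; apply/nrm0_eq0/eqP.
have : nrm (x n) `^ p == 0 by rewrite eq_le xn0 powR_ge0.
by rewrite powR_eq0 => /andP[].
Qed.

HB.instance Definition _ := Lmodule_isNormed.Build K lp
  lp_normD lp_normZ lp_norm0.

Lemma lp_sum_normE (x : lp) : `|x| = embK k (lp_norm x).
Proof. by []. Qed.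

Lemma lp_sum_nrmE (x : lp) : nrm x = lp_norm x.
Proof. exact: embKK. Qed.

End LpSum.

Section Geometry.
Variables (R : realType) (k : scalars).
Local Notation K := (scalarK R k).
Variable X : normedModType K.
Implicit Types (x y z : X) (ip : X -> X -> K).

Definition nontrivial := exists v : X, v != 0.

Definition bj_orth x y := forall l : K, `|x| <= `|x + l *: y|.

Definition left_symmetric x := forall y, bj_orth x y -> bj_orth y x.

Definition right_symmetric x := forall y, bj_orth y x -> bj_orth x y.

Definition dual_norm (f : X -> K^o) : \bar R :=
  ereal_sup [set (nrm (f v))%:E | v in [set v : X | `|v| <= 1]].

Definition smooth x := x != 0 /\
  exists! f : X -> K^o,
    [/\ linear f, continuous f, dual_norm f = 1%E & f x = `|x|].

Definition is_sip ip :=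
  [/\ forall x, ip x x = `|x| ^+ 2,
      forall x y z (l : K), ip x y + l * ip x z = ip x (y + l *: z),
      forall x y (l : K), ip (l *: x) y = conjK l * ip x y
    & forall x y, `|ip x y| ^+ 2 <= ip x x * ip y y].

(* |c / (|x| |y|)|^(p - 2) * conj c, for c a value of an s.i.p. at (x, y).
   It is 0 when c = 0, whatever the value of the power. *)
Definition sip_power (p : R) x y (c : K) : K :=
  embK k (reK `|c / (`|x| * `|y|)| `^ (p - 2)) * conjK c.

Definition left_sip_symmetric (p : R) x := forall y, y != 0 ->
  forall ip, is_sip ip ->
  exists ip', is_sip ip' /\ ip' y x = sip_power p x y (ip x y).

Definition right_sip_symmetric (p : R) x := forall y, y != 0 ->
  forall ip, is_sip ip ->
  exists ip', is_sip ip' /\ ip y x = sip_power p x y (ip' x y).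

End Geometry.

(* Main.v *)
Require Import Defs.
From HB Require Import structures.
From mathcomp Require Import all_boot all_order all_algebra.
From mathcomp Require Import all_classical all_reals all_analysis.
From mathcomp Require Import complex ring lra.

Set Implicit Arguments.
Unset Strict Implicit.
Unset Printing Implicit Defensive.

Import Order.TTheory GRing.Theory Num.Theory.
Import numFieldNormedType.Exports.

Local Open Scope classical_set_scope.
Local Open Scope ring_scope.

(** Single out a coordinate [m] with [x m != 0]. The sum is then [X m] plus the
    rest, with [|(y, c w)|^p = |y|^p + |c|^p B], where [w] is [x] without its
    coordinate [m] and [B = |w|^p]. Orthogonality of such vectors is first-order
    minimality of a sum of two [p]-th powers. If [B > 0], testing the symmetry of
    [x = (x m, w)] on vectors [(a x m, c w)] forces [B = |x m|^p], because
    [p != 2]. So each non-zero coordinate carries exactly half of [|x|^p], and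
    there are exactly two of them.

    Then symmetry is tested on [(y, c w)], with [c] chosen so that a given
    support functional makes the hypothesis of orthogonality true. The resulting
    orthogonality gives a one-sided derivative bound on [|y + l x m|] (left case)
    or on [|x m + l y|] (right case), and Hahn-Banach turns it into a support
    functional with a prescribed value. A semi-inner product is a homogeneous
    choice of support functionals, so changing it on a single line suffices.
    Smoothness in the left case: two distinct support functionals at [x m] give
    contradictory derivative bounds at [w] and [w + t x m], where [w] is a kernel
    vector of one of them. *)

(** * Scalars and powers of the modulus *)

Section ScalarTheory.
Variables (R : realType) (k : scalars).
Local Notation K := (scalarK R k).
Local Notation emb := (@embK R k).
Local Notation re := (@reK R k).
Local Notation conj := (@conjK R k).
Implicit Types (r s t : R) (z w : K).

Lemma embKB : zmod_morphism emb.
Proof. by case: k => // r s; rewrite /= -[LHS]/(real_complex _ _) rmorphB. Qed.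

Lemma embK_monoid : monoid_morphism emb.
Proof. by split; [case: k | exact: embKM]. Qed.

HB.instance Definition _ := GRing.isZmodMorphism.Build R K emb embKB.
HB.instance Definition _ := GRing.isMonoidMorphism.Build R K emb embK_monoid.

Lemma reKB : zmod_morphism re.
Proof. by case: k => // -[a b] [c d]. Qed.

HB.instance Definition _ := GRing.isZmodMorphism.Build K R re reKB.

Lemma reKD z w : re (z + w) = re z + re w.
Proof. exact: raddfD. Qed.

Lemma conjKB : zmod_morphism conj.
Proof. by case: k => //= z w; rewrite rmorphB. Qed.

Lemma conjK_monoid : monoid_morphism conj.
Proof.
by case: k; split => //=; [exact: conjc1 | move=> z w; rewrite rmorphM].
Qed.

HB.instance Definition _ := GRing.isZmodMorphism.Build K K conj conjKB.
HB.instance Definition _ := GRing.isMonoidMorphism.Build K K conj conjK_monoid.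

Lemma reK_embM r z : re (emb r * z) = r * re z.
Proof. by case: k z => //= -[a b] /=; rewrite mul0r subr0. Qed.

Lemma ler_embK r s : (emb r <= emb s) = (r <= s).
Proof. by case: k => //=; rewrite lecE /= eqxx. Qed.

Lemma conjK_emb r : conj (emb r) = emb r.
Proof. by case: k => //=; rewrite oppr0. Qed.

Lemma conjKK : involutive conj.
Proof. by case: k => //; exact: conjcK. Qed.

Lemma norm_embK r : `|emb r| = emb `|r|.
Proof. by case: k => //=; rewrite normc_def /= expr0n /= addr0 sqrtr_sqr. Qed.

Definition modK z : R := re `|z|.

Lemma modKE z : emb (modK z) = `|z|.
Proof. exact: reKK. Qed.

Lemma modK_ge0 z : 0 <= modK z.
Proof. by rewrite -[leLHS](embKK k) embK0; exact: reK_le. Qed.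

Lemma modKM z w : modK (z * w) = modK z * modK w.
Proof. by rewrite -[RHS](embKK k) rmorphM /= !modKE -normrM. Qed.

Lemma modKD z w : modK (z + w) <= modK z + modK w.
Proof.
by rewrite -[leRHS](embKK k) rmorphD /= !modKE; apply/reK_le/ler_normD.
Qed.

Lemma modKN z : modK (- z) = modK z.
Proof. by rewrite /modK normrN. Qed.

Lemma modK_emb r : modK (emb r) = `|r|.
Proof. by rewrite /modK norm_embK embKK. Qed.

Lemma modK0 : modK 0 = 0.
Proof. by rewrite /modK normr0 raddf0. Qed.

Lemma modK1 : modK 1 = 1.
Proof. by rewrite -(rmorph1 emb) modK_emb normr1. Qed.

Lemma modK_eq0 z : (modK z == 0) = (z == 0).
Proof.
apply/eqP/eqP => [z0|->]; last exact: modK0.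
by apply/normr0_eq0; rewrite -modKE z0 raddf0.
Qed.

Lemma modK_gt0 z : (0 < modK z) = (z != 0).
Proof. by rewrite lt_def modK_ge0 andbT modK_eq0. Qed.

Lemma modK_conj z : modK (conj z) = modK z.
Proof. by rewrite /modK; case: k z => // z; rewrite [conjK _]/(conjc _) normcJ. Qed.

Lemma mul_conjK z : conj z * z = emb (modK z ^+ 2).
Proof.
rewrite rmorphXn /= modKE mulrC.
case: k z => /= z; last by rewrite -sqr_normc.
by rewrite real_normK ?num_real// expr2.
Qed.

Lemma reK_le_mod z : re z <= modK z.
Proof.
rewrite /modK; case: k z => [|z]; first exact: ler_norm.
rewrite /reK normc_def /=; apply: le_trans (ler_norm _) _.
by rewrite -sqrtr_sqr ler_wsqrtr// lerDl sqr_ge0.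
Qed.

Lemma reK_eq_mod z : re z = modK z -> z = emb (modK z).
Proof.
rewrite /modK; case: k z => [z /= <-//|[a b]].
rewrite /reK normc_def /= => ha.
have a0 : 0 <= a by rewrite ha sqrtr_ge0.
have : a ^+ 2 = a ^+ 2 + b ^+ 2.
  by rewrite {1}ha sqr_sqrtr// addr_ge0 ?sqr_ge0.
move=> /eqP; rewrite -subr_eq0 opprD addNKr oppr_eq0 sqrf_eq0 => /eqP b0.
by rewrite -ha b0.
Qed.

End ScalarTheory.

(** * Convexity of real powers and the gradient of the p-th power of the modulus *)

Lemma powR_continuous (R : realType) (r a : R) : 0 < a ->
  {for a, continuous (@powR R ^~ r)}.
Proof.
move=> a0; apply/differentiable_continuous/derivable1_diffP.
by apply: ex_derive; exact: is_derive1_powR.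
Qed.

Section PowerTangent.
Variables (R : realType) (k : scalars) (p : R).
Hypothesis p_gt1 : 1 < p.
Local Notation K := (scalarK R k).
Local Notation emb := (@embK R k).
Local Notation re := (@reK R k).
Local Notation conj := (@conjK R k).
Implicit Types (a s : R) (z h c d l : K).

Lemma powR_mulB1 a : 0 <= a -> a `^ p = a * a `^ (p - 1).
Proof.
move=> a0; have p1 := p_gt1; have {1}-> : p = 1 + (p - 1) by ring.
by rewrite (@powRD _ a 1 (p - 1)) ?powRr1//; apply/implyP => /eqP; lra.
Qed.

(** Young's inequality for [s] and a^(p-1), with conjugate exponents [p] and [p / (p - 1)],
    rearranges into this convexity bound and covers [a = 0] as well. *)
Lemma powR_tangent a s : 0 <= a -> 0 <= s ->
  a `^ p + p * (a `^ (p - 1) * (s - a)) <= s `^ p.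
Proof.
move=> a0 s0; have p1 := p_gt1; have p0 : 0 < p by lra.
have p10 : p - 1 != 0 by lra.
have := @conjugate_powR R s (a `^ (p - 1)) p (p / (p - 1)) s0 (powR_ge0 _ _) p0.
have -> : p^-1 + (p / (p - 1))^-1 = 1 by field; rewrite ?p10 ?gt_eqF.
have -> : (a `^ (p - 1)) `^ (p / (p - 1)) = a `^ p.
  by rewrite -powRrM mulrC divfK.
have q0 : 0 < p / (p - 1) by rewrite divr_gt0//; lra.
move=> /(_ q0 erefl) young.
have H : p * (s * a `^ (p - 1)) <= p * (s `^ p / p + a `^ p / (p / (p - 1))).
  by rewrite ler_wpM2l ?young// ltW.
have E : p * (s `^ p / p + a `^ p / (p / (p - 1))) = s `^ p + (p - 1) * a `^ p.
  by field; rewrite ?p10 ?gt_eqF.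
by rewrite E !(powR_mulB1 a0) in H; rewrite (powR_mulB1 a0); lra.
Qed.

(* [c |-> |c|^(p-2) conj c] is, up to the factor [p], the gradient of [|c|^p]. *)
Definition dualK c : K := emb (modK c `^ (p - 2)) * conj c.

Lemma dualK0 : dualK 0 = 0.
Proof. by rewrite /dualK raddf0 mulr0. Qed.

Lemma powRB1 a : 0 <= a -> a `^ (p - 1) = a * a `^ (p - 2).
Proof.
move=> a0; have p1 := p_gt1; have -> : p - 1 = 1 + (p - 2) by ring.
by rewrite (@powRD _ a 1 (p - 2)) ?powRr1//; apply/implyP => /eqP; lra.
Qed.

Lemma dualK_emb a : 0 <= a -> dualK (emb a) = emb (a `^ (p - 1)).
Proof.
move=> a0; rewrite /dualK modK_emb ger0_norm// conjK_emb -rmorphM /=.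
by rewrite powRB1// mulrC.
Qed.

Lemma dualKM c d : dualK (c * d) = dualK c * dualK d.
Proof. by rewrite /dualK modKM powRM ?modK_ge0// !rmorphM /=; ring. Qed.

Lemma dualKN c : dualK (- c) = - dualK c.
Proof. by rewrite /dualK modKN rmorphN mulrN. Qed.

(** Cauchy-Schwarz for scalars: the real part of conj(z) (z + h), which is Re(conj(z) h) + |z|^2, is
    at most |z| |z + h|. *)
Lemma dualK_le z h :
  re (dualK z * h) <= modK z `^ (p - 1) * (modK (z + h) - modK z).
Proof.
rewrite /dualK -mulrA reK_embM powRB1 ?modK_ge0// mulrAC mulrC.
rewrite ler_wpM2r ?powR_ge0// mulrBr -expr2 lerBrDr.
have -> : re (conj z * h) + modK z ^+ 2 = re (conj z * (z + h)).
  by rewrite mulrDr reKD mul_conjK embKK addrC.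
by apply: le_trans (reK_le_mod _) _; rewrite modKM modK_conj.
Qed.

Lemma modK_tangent z h :
  modK z `^ p + p * re (dualK z * h) <= modK (z + h) `^ p.
Proof.
apply: le_trans (powR_tangent (modK_ge0 z) (modK_ge0 (z + h))).
by rewrite lerD2l ler_wpM2l ?dualK_le// ltW// (lt_trans _ p_gt1).
Qed.

Lemma dualK_cvg c h :
  re (dualK (c + emb t * h) * h) @[t --> 0^'+] --> re (dualK c * h).
Proof.
have p1 := p_gt1; have near01 (P : R -> Prop) :
    (forall t, 0 < t -> P t) -> \forall t \near 0^'+, P t.
  by move=> HP; near=> t; apply: HP; near: t; exact: nbhs_right_gt.
(* At [c = 0] the factor |c|^(p-2) may blow up when p < 2. There the expression equals t^(p-1)
   |h|^p, which tends to 0 because p > 1. *)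
have [->|c0] := eqVneq c 0.
  rewrite dualK0 mul0r raddf0.
  have : modK h `^ p * t `^ (p - 1) @[t --> 0^'+] --> modK h `^ p * (0 : R).
    by apply: cvgM; [exact: cvg_cst | apply: powR_cvg0; lra].
  rewrite mulr0; apply: cvg_trans; apply: near_eq_cvg; apply: near01 => t t0.
  rewrite add0r dualKM dualK_emb ?ltW// -mulrA reK_embM mulrC; congr (_ * _).
  rewrite /dualK -mulrA reK_embM mul_conjK embKK expr2.
  rewrite powR_mulB1 ?modK_ge0// powRB1 ?modK_ge0//; ring.
have modc : modK (c + emb t * h) @[t --> 0^'+] --> modK c.
  have b : t * modK h @[t --> (0:R)^'+] --> (0 : R).
    rewrite -[X in _ --> X](mul0r (modK h)).
    by apply: cvgM; [exact: cvg_at_right_filter cvg_id | exact: cvg_cst].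
  apply: (@squeeze_cvgr _ _ _ _ (fun t => modK c - t * modK h)
     (fun t => modK c + t * modK h)).
  - apply: near01 => t t0.
    have mt : modK (emb t * h) = t * modK h by rewrite modKM modK_emb gtr0_norm.
    apply/andP; split; last by rewrite -mt modKD.
    rewrite lerBlDr -mt; have := modKD (c + emb t * h) (- (emb t * h)).
    by rewrite addrK modKN.
  - by rewrite -[X in _ --> X]subr0; apply: cvgB => //; exact: cvg_cst.
  - by rewrite -[X in _ --> X]addr0; apply: cvgD => //; exact: cvg_cst.
have pw : modK (c + emb t * h) `^ (p - 2) @[t --> 0^'+] --> modK c `^ (p - 2).
  apply: (@cvg_comp _ _ _ (fun t => modK (c + emb t * h)) (@powR R ^~ (p - 2))
    _ _ _ modc).
  by apply: powR_continuous; rewrite modK_gt0.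
have E t : re (dualK (c + emb t * h) * h) =
    modK (c + emb t * h) `^ (p - 2) * (re (conj c * h) + t * modK h ^+ 2).
  rewrite /dualK -mulrA reK_embM rmorphD rmorphM /= conjK_emb mulrDl reKD.
  by rewrite -mulrA reK_embM mul_conjK embKK.
under eq_fun do rewrite E.
rewrite /dualK -mulrA reK_embM; apply: cvgM => //.
rewrite -[X in _ --> X]addr0; apply: cvgD; first exact: cvg_cst.
rewrite -[X in _ --> X](mul0r (modK h ^+ 2)).
by apply: cvgM; [exact: cvg_at_right_filter cvg_id | exact: cvg_cst].
Unshelve. all: by end_near. Qed.

End PowerTangent.

(** * First-order conditions for minimality of a sum of two p-th powers *)

Section OneSidedDerivative.
Variables (R : realType) (k : scalars) (p : R).
Hypothesis p_gt1 : 1 < p.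
Local Notation K := (scalarK R k).
Local Notation emb := (@embK R k).
Local Notation re := (@reK R k).
Variable V : normedModType K.
Implicit Types (u v : V) (c d l : K) (B t : R).

Lemma nrm_gt0 v : v != 0 -> 0 < nrm v.
Proof.
move=> v0; rewrite lt_def nrm_ge0 andbT.
by apply: contra_neq v0; exact: nrm0_eq0.
Qed.

Lemma nrm_modZ l v : nrm (l *: v) = modK l * nrm v.
Proof. exact: nrmZ. Qed.

Lemma nrm_embZ t v : 0 <= t -> nrm (emb t *: v) = t * nrm v.
Proof. by move=> t0; rewrite nrm_modZ modK_emb ger0_norm. Qed.

Lemma nrm_segment u v l t : 0 <= t -> t <= 1 ->
  nrm (u + (emb t * l) *: v) <= nrm u + t * (nrm (u + l *: v) - nrm u).
Proof.
move=> t0 t1.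
have -> : u + (emb t * l) *: v = emb (1 - t) *: u + emb t *: (u + l *: v).
  by rewrite scalerDr scalerA addrA -scalerDl -rmorphD /= subrK rmorph1 scale1r.
apply: le_trans (ler_nrmD _ _) _; rewrite !nrm_embZ ?subr_ge0//; lra.
Qed.

(** The necessary condition at a minimum. The norm need not be differentiable, so its one-sided
    derivative is replaced by the chord increment [D], which bounds it from above by convexity. *)
Lemma power_sum_derivative_ge0 u v c d B : u != 0 -> 0 <= B ->
  (forall l, nrm u `^ p + B * modK c `^ p
     <= nrm (u + l *: v) `^ p + B * modK (c + l * d) `^ p) ->
  forall l, 0 <= nrm u `^ (p - 1) * (nrm (u + l *: v) - nrm u)
                 + B * re (dualK p c * (l * d)).
Proof.
move=> u0 B0 H l; have p1 := p_gt1; have N0 := nrm_gt0 u0.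
set N := nrm u in N0 H *; set D := _ - N; set h := l * d.
have step t : 0 < t -> t <= 1 ->
    0 <= (N + t * D) `^ (p - 1) * D + B * re (dualK p (c + emb t * h) * h).
  move=> t0 t1; have := H (emb t * l); rewrite -mulrA -/h => Ht.
  have seg := nrm_segment u v l (ltW t0) t1; rewrite -/N -/D in seg.
  have ND0 : 0 <= N + t * D := le_trans (nrm_ge0 _) seg.
  have pw : nrm (u + (emb t * l) *: v) `^ p <= (N + t * D) `^ p.
    by rewrite ge0_ler_powR ?nnegrE ?nrm_ge0//; lra.
  (* Both tangents are taken at the displaced points, not at the base point: this bounds the
     increments from above by [t] times a gradient, and that gradient converges as [t] tends to
     0. *)
  have T1 := powR_tangent p_gt1 ND0 (ltW N0).
  have T2 := modK_tangent p_gt1 (c + emb t * h) (- (emb t * h)).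
  have e z : z * - (emb t * h) = emb (- t) * (z * h) by rewrite rmorphN /=; ring.
  rewrite addrK e reK_embM in T2.
  have T3 := ler_wpM2l B0 T2.
  set a := (N + t * D) `^ (p - 1) in T1 *; set b := re _ in T2 T3 *.
  have : 0 <= p * t * (a * D + B * b) by lra.
  by rewrite pmulr_rge0// mulr_gt0//; lra.
have lim : (N + t * D) `^ (p - 1) * D + B * re (dualK p (c + emb t * h) * h)
    @[t --> 0^'+] --> N `^ (p - 1) * D + B * re (dualK p c * h).
  have cvgN : N + t * D @[t --> (0:R)^'+] --> N.
    rewrite -[X in _ --> X]addr0; apply: cvgD; first exact: cvg_cst.
    rewrite -[X in _ --> X](mul0r D).
    by apply: cvgM; [exact: cvg_at_right_filter cvg_id | exact: cvg_cst].
  apply: cvgD; apply: cvgM; try exact: cvg_cst; last exact: dualK_cvg.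
  apply: (@cvg_comp _ _ _ (fun t => N + t * D) (@powR R ^~ (p - 1)) _ _ _ cvgN).
  exact: powR_continuous.
apply: (cvgr_to_ge lim); near=> t; apply: step.
  by near: t; exact: nbhs_right_gt.
by near: t; exact: nbhs_right_le.
Unshelve. all: by end_near. Qed.

(** The sufficient condition: [g] is a subgradient of the norm at [u] in the direction [v], and a
    convex function with a vanishing subgradient is minimal there. *)
Lemma power_sum_min u v c d B (g : K) : 0 <= B ->
  (forall l, nrm u + re (l * g) <= nrm (u + l *: v)) ->
  emb (nrm u `^ (p - 1)) * g + emb B * (dualK p c * d) = 0 ->
  forall l, nrm u `^ p + B * modK c `^ p
     <= nrm (u + l *: v) `^ p + B * modK (c + l * d) `^ p.
Proof.
move=> B0 H E l; have p1 := p_gt1.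
have T1 := powR_tangent p_gt1 (nrm_ge0 u) (nrm_ge0 (u + l *: v)).
have T2 := ler_wpM2l B0 (modK_tangent p_gt1 c (l * d)).
have : re (l * (emb (nrm u `^ (p - 1)) * g + emb B * (dualK p c * d))) = 0.
  by rewrite E mulr0 raddf0.
have -> : l * (emb (nrm u `^ (p - 1)) * g + emb B * (dualK p c * d)) =
  emb (nrm u `^ (p - 1)) * (l * g) + emb B * (dualK p c * (l * d)) by ring.
rewrite reKD !reK_embM => {}E.
have T3 : nrm u `^ (p - 1) * re (l * g)
    <= nrm u `^ (p - 1) * (nrm (u + l *: v) - nrm u).
  by rewrite ler_wpM2l ?powR_ge0// lerBrDl.
have : p * (nrm u `^ (p - 1) * re (l * g))
    <= p * (nrm u `^ (p - 1) * (nrm (u + l *: v) - nrm u)).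
  by rewrite ler_wpM2l//; lra.
have -> : nrm u `^ (p - 1) * re (l * g) = - (B * re (dualK p c * (l * d))) by lra.
lra.
Qed.

End OneSidedDerivative.

(** * The Hahn-Banach theorem *)

Section HahnBanach.
Variables (R : realType) (k : scalars).
Local Notation K := (scalarK R k).
Local Notation emb := (@embK R k).
Local Notation re := (@reK R k).

Section Sublinear.
Variable V : lmodType K.
Implicit Types (q : V -> R) (v w : V) (t : R).

Definition sublinear q := (forall v w, q (v + w) <= q v + q w) /\
  (forall t v, 0 <= t -> q (emb t *: v) = t * q v).

Lemma sublinear0 q : sublinear q -> q 0 = 0.
Proof. by move=> [_ /(_ 0 0 (lexx 0))]; rewrite scaler0 mul0r. Qed.

Lemma sublinear_opp q v : sublinear q -> - q (- v) <= q v.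
Proof.
move=> sq; have [add _] := sq; have := add v (- v).
by rewrite subrr sublinear0//; lra.
Qed.

(* The extension step: [q'] is the largest sublinear functional below [q] such
   that every linear functional below [q'] is at least [a.2] at [a.1], for all
   [a] in the convex cone [C]. *)
Lemma sublinear_cone q (C : set (V * R)) : sublinear q ->
  C (0, 0) -> (forall a b, C a -> C b -> C (a.1 + b.1, a.2 + b.2)) ->
  (forall t a, 0 <= t -> C a -> C (emb t *: a.1, t * a.2)) ->
  (forall a, C a -> a.2 <= q a.1) ->
  exists q', [/\ sublinear q', forall v, q' v <= q v &
    forall a, C a -> q' (- a.1) <= - a.2].
Proof.
move=> sq C0 CD CZ Cq; have [add scal] := sq.
pose E v := [set q (v + a.1) - a.2 | a in C]; pose q' v := inf (E v).
(* This bound makes the infimum finite; it comes from subadditivity and the hypothesis that [q]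
   dominates the cone. *)
have lb v : lbound (E v) (- q (- v)).
  move=> _ [a Ca <-]; have := add (v + a.1) (- v); have := Cq _ Ca.
  by rewrite [v + _]addrC addrK; lra.
have q'le v a : C a -> q' v <= q (v + a.1) - a.2.
  by move=> Ca; apply: ge_inf; [exists (- q (- v)); exact: lb | exists a].
have q'ge v m : (forall a, C a -> m <= q (v + a.1) - a.2) -> m <= q' v.
  move=> H; apply: lb_le_inf; first by exists (q (v + 0) - 0), (0, 0).
  by move=> _ [a Ca <-]; exact: H.
have q'q v : q' v <= q v by have := q'le v _ C0; rewrite addr0 subr0.
(* One inequality is enough: the reverse one is its instance at [t^-1] and [emb t *: v]. *)
have q'Z t v : 0 < t -> t * q' v <= q' (emb t *: v).
  move=> t0; apply: (q'ge) => a Ca.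
  have ti : 0 <= t^-1 by rewrite invr_ge0 ltW.
  have := q'le v _ (CZ _ _ ti Ca); rewrite /= -(ler_pM2l t0) => /le_trans; apply.
  rewrite mulrBr mulrA divff ?gt_eqF// mul1r -(scal _ _ (ltW t0)) scalerDr scalerA.
  by rewrite -rmorphM /= divff ?gt_eqF// rmorph1 scale1r.
exists q'; split => //; last first.
  by move=> a Ca; have := q'le (- a.1) _ Ca; rewrite addNr sublinear0// sub0r.
split=> [v w|t v].
  rewrite -lerBlDr; apply: (q'ge) => a Ca; rewrite lerBlDr -lerBlDl.
  apply: (q'ge) => b Cb; rewrite lerBlDl.
  apply: le_trans (q'le _ _ (CD _ _ Ca Cb)) _ => /=.
  have := add (v + a.1) (w + b.1).
  by rewrite addrACA; lra.
rewrite (le_eqVlt 0 t) => /predU1P[<-|t0].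
  rewrite mul0r rmorph0 scale0r; apply/eqP; rewrite eq_le.
  have := q'q 0; rewrite (sublinear0 sq) => -> /=.
  apply: lb_le_inf; first by exists (q (0 + 0) - 0), (0, 0).
  by have := lb 0; rewrite oppr0 (sublinear0 sq) oppr0.
apply/eqP; rewrite eq_le q'Z// andbT.
have ti : 0 < t^-1 by rewrite invr_gt0.
have := q'Z _ (emb t *: v) ti; rewrite scalerA -rmorphM /= mulVf ?gt_eqF//.
by rewrite rmorph1 scale1r ler_pdivrMl.
Qed.

(** Zorn's lemma for the reversed pointwise order. A non-empty chain is bounded by its pointwise
    infimum, finite because every member is at least - q (- v) at [v]; it stays subadditive because
    two members of a chain are comparable. *)
Lemma sublinear_minimal q : sublinear q -> exists q0,
  [/\ sublinear q0, forall v, q0 v <= q v &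
    forall q', sublinear q' -> (forall v, q' v <= q0 v) -> q' = q0].
Proof.
move=> sq; pose T := {f : V -> R | sublinear f /\ forall v, f v <= q v}.
pose r (f g : T) := `[< forall v, sval g v <= sval f v >].
have [||||[f [sf fq]] fmax] := @Zorn T r.
- by move=> f; apply/asboolP.
- move=> f g h /asboolP fg /asboolP gh; apply/asboolP => v.
  exact: le_trans (gh v) (fg v).
- move=> [f Pf] [g Pg] /asboolP/= fg /asboolP/= gf.
  have e : f = g by apply/funext => v; apply/eqP; rewrite eq_le fg gf.
  by case: g / e Pg {fg gf} => Pg; rewrite (Prop_irrelevance Pf Pg).
- move=> A Atot; have [[f0 Af0]|A0] := pselect (exists f, A f); last first.
    have Pq : sublinear q /\ forall v, q v <= q v by [].
    by exists (exist _ q Pq) => s As; case: A0; exists s.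
  pose E v := [set sval f v | f in A]; pose h v := inf (E v).
  have lb v : lbound (E v) (- q (- v)).
    move=> _ [[f [sf fq]] Af <-] /=; have := fq (- v).
    by have := sublinear_opp v sf; lra.
  have hle v f : A f -> h v <= sval f v.
    by move=> Af; apply: ge_inf; [exists (- q (- v)); exact: lb | exists f].
  have hge v m : (forall f, A f -> m <= sval f v) -> m <= h v.
    move=> H; apply: lb_le_inf; first by exists (sval f0 v), f0.
    by move=> _ [a Ca <-]; exact: H.
  have sh : sublinear h.
    split=> [v w|t v].
      rewrite -lerBlDr; apply: (hge) => f Af; rewrite lerBlDr -lerBlDl.
      apply: (hge) => g Ag; rewrite lerBlDl.
      have [/asboolP fg|/asboolP gf] := Atot _ _ Af Ag.
        apply: le_trans (hle _ _ Ag) _; case: (svalP g) => -[+ _] _ => /(_ v w).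
        by have := fg v; lra.
      apply: le_trans (hle _ _ Af) _; case: (svalP f) => -[+ _] _ => /(_ v w).
      by have := gf w; lra.
    move=> t0; apply/eqP; rewrite eq_le; apply/andP; split.
      move: t0; rewrite (le_eqVlt 0 t) => /predU1P[<-|t0].
        have := hle (emb 0 *: v) _ Af0; case: (svalP f0) => -[_ +] _.
        by move=> /(_ 0 v (lexx 0)) ->; rewrite !mul0r.
      rewrite mulrC -ler_pdivrMr//; apply: (hge) => f Af; rewrite ler_pdivrMr// mulrC.
      by have := hle (emb t *: v) _ Af; case: (svalP f) => -[_ ->] //; exact: ltW.
    apply: (hge) => f Af; case: (svalP f) => -[_ ->] // _.
    by rewrite ler_wpM2l// hle.
  have Ph : sublinear h /\ forall v, h v <= q v.
    split=> // v; apply: le_trans (hle _ _ Af0) _.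
    by case: (svalP f0).
  by exists (exist _ h Ph) => s As; apply/asboolP => v /=; exact: hle.
exists f; split=> // g sg gf.
have Pg : sublinear g /\ forall v, g v <= q v.
  by split=> // v; exact: le_trans (gf v) (fq v).
have := fmax (exist _ g Pg); rewrite /r asboolT// => /(_ isT).
by move=> /(congr1 sval).
Qed.

(** A minimal sublinear functional is linear: prescribing its own value along the ray of [v] gives a
    sublinear functional below it, hence equal to it, and this yields G (- v) <= - G v. *)
Lemma real_hahn_banach q : sublinear q -> exists G : V -> R,
  [/\ forall v w, G (v + w) = G v + G w, forall t v, G (emb t *: v) = t * G v &
      forall v, G v <= q v].
Proof.
move=> /sublinear_minimal[G [sG Gq Gmin]]; exists G.
have [add scal] := sG.
have oppG v : G (- v) = - G v.
  pose C := [set a : V * R | exists2 t, 0 <= t & a = (emb t *: v, t * G v)].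
  have [||||q' [sq' q'G q'C]] := @sublinear_cone G C sG.
  - by exists 0 => //; rewrite rmorph0 scale0r mul0r.
  - move=> _ _ [s s0 ->] [t t0 ->] /=; exists (s + t); first exact: addr_ge0.
    by rewrite rmorphD /= scalerDl mulrDl.
  - move=> t _ t0 [s s0 ->] /=; exists (t * s); first exact: mulr_ge0.
    by rewrite scalerA rmorphM /= mulrA.
  - by move=> _ [t t0 ->] /=; rewrite scal.
  have := q'C (v, G v); rewrite (Gmin _ sq' q'G) /= => GN.
  have {}GN : G (- v) <= - G v.
    by apply: GN; exists 1; rewrite ?ler01// rmorph1 scale1r mul1r.
  by apply/eqP; rewrite eq_le GN /=; have := sublinear_opp v sG; lra.
split=> // [v w|t v].
  apply/eqP; rewrite eq_le add /=.
  by have := add (v + w) (- w); rewrite addrK oppG; lra.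
have [t0|t0] := leP 0 t; first exact: scal.
have := scal (- t) v; rewrite oppr_ge0 (ltW t0) => /(_ isT).
by rewrite rmorphN /= scaleNr oppG mulNr => /oppr_inj.
Qed.

End Sublinear.

(** In the complex case the functional is G v - i G (i v). *)
Lemma functional_of_real_part (V : lmodType K) (G : V -> R) :
  (forall v w, G (v + w) = G v + G w) -> (forall t v, G (emb t *: v) = t * G v) ->
  exists f : V -> K^o, linear f /\ forall v, re (f v) = G v.
Proof.
case: k V G => [V G GD GZ|V G GD GZ].
  by exists G; split=> // a u v; rewrite GD -[a]/(embK RealScalars a) GZ.
pose i : R[i] := Complex 0 1.
have GC (a b : R) v : G ((Complex a b : scalarK R ComplexScalars) *: v)
    = a * G v + b * G (i *: v).
  rewrite -!GZ -GD scalerA -scalerDl; congr (G (_ *: _)).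
  by apply/eqP; rewrite eq_complex /=; apply/andP; split; apply/eqP; ring.
exists (fun v => Complex (G v) (- G (i *: v))); split=> // -[a b] u v.
rewrite scalerDr scalerA !GD.
have -> : i * Complex a b = Complex (- b) a.
  by apply/eqP; rewrite eq_complex /=; apply/andP; split; apply/eqP; ring.
rewrite (GC a b) (GC (- b) a); apply/eqP; rewrite eq_complex /=; apply/andP.
by split; apply/eqP; ring.
Qed.

(** Hahn-Banach with values prescribed on the cone of vectors t u + l v, t >= 0. All scalars [l] are
    allowed, so the lower bound along [v] becomes the equality [f v = g]. *)
Lemma norming_functional (V : normedModType K) (u v : V) (g : K) :
  (forall l, nrm u + re (l * g) <= nrm (u + l *: v)) ->
  exists f : V -> K^o, [/\ linear f, forall w, modK (f w) <= nrm w,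
    f u = emb (nrm u) & f v = g].
Proof.
move=> H.
have nrmZ' (t : R) (w : V) : 0 <= t -> nrm (emb t *: w) = t * nrm w.
  by move=> t0; rewrite nrmZ [X in X * _]modK_emb ger0_norm.
have sq : sublinear (@nrm R k V) by split=> *; [exact: ler_nrmD | exact: nrmZ'].
pose C := [set a : V * R | exists t l, 0 <= t /\
  a = (emb t *: u + l *: v, t * nrm u + re (l * g))].
have Cl l : C (l *: v, re (l * g)).
  by exists 0, l; rewrite rmorph0 scale0r mul0r !add0r.
have [||||q [sqq q_nrm qC]] := @sublinear_cone V _ C sq.
- by exists 0, 0; rewrite rmorph0 !scale0r !mul0r raddf0 !addr0.
- move=> _ _ [s [l [s0 ->]]] [t [m [t0 ->]]] /=; exists (s + t), (l + m).
  rewrite addr_ge0//; split=> //.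
  by rewrite rmorphD /= !scalerDl !mulrDl reKD !addrA; congr (_, _);
    [rewrite -!addrA; congr (_ + _); rewrite addrCA | ring].
- move=> t _ t0 [s [l [s0 ->]]] /=; exists (t * s), (emb t * l).
  rewrite mulr_ge0//; split=> //.
  by rewrite scalerDr !scalerA rmorphM /= -[emb t * l * g]mulrA reK_embM mulrDr mulrA.
(* For t = 0 the hypothesis and the triangle inequality give Re(l g) <= |l v|; for t > 0 the
   hypothesis is rescaled by [t]. *)
- move=> _ [t [l [t0 ->]]] /=; move: t0; rewrite (le_eqVlt 0 t) => /predU1P[<-|t0].
    rewrite rmorph0 scale0r mul0r !add0r -(lerD2l (nrm u)).
    by apply: le_trans (H l) _; exact: ler_nrmD.
  have := H (emb t^-1 * l); rewrite -(ler_pM2l t0) -(nrmZ' _ _ (ltW t0)).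
  rewrite scalerDr scalerA mulrA -rmorphM /= divff ?gt_eqF// rmorph1 mul1r.
  by rewrite -mulrA reK_embM mulrDr mulrA divff ?gt_eqF// mul1r.
have [G [GD GZ Gq]] := real_hahn_banach sqq.
have [f [fL fG]] := functional_of_real_part GD GZ.
have GN w : G (- w) = - G w by rewrite -scaleN1r -(rmorphN1 emb) GZ mulN1r.
have fZ l w : f (l *: w) = l * f w := GRing.scalable_linear fL l w.
have GC a : C a -> a.2 <= G a.1.
  by move=> /qC /(le_trans (Gq _)); rewrite GN lerN2.
have f_le w : modK (f w) <= nrm w.
  have [->|fw0] := eqVneq (f w) 0; first by rewrite modK0 nrm_ge0.
  have m0 : modK (f w) != 0 by rewrite modK_eq0.
  (* Multiplying by this unimodular scalar makes [f] real and non-negative at [w], which turns the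
     bound on the real part into a bound on the modulus. *)
  pose c := emb (modK (f w))^-1 * conjK (f w).
  have -> : modK (f w) = G (c *: w).
    rewrite -fG fZ /c -mulrA mul_conjK -rmorphM /= embKK expr2 mulKf//.
  apply: le_trans (Gq _) _; apply: le_trans (q_nrm _) _.
  rewrite nrmZ [X in X * _]modKM modK_emb modK_conj ger0_norm ?invr_ge0 ?modK_ge0//.
  by rewrite mulVf// mul1r.
exists f; split=> //.
  have := GC (u, nrm u); rewrite /= -fG => Hu.
  have {}Hu : nrm u <= re (f u).
    apply: Hu; exists 1, 0.
    by rewrite rmorph1 scale1r scale0r mul0r raddf0 mul1r !addr0.
  have e : re (f u) = modK (f u).
    by apply/eqP; rewrite eq_le reK_le_mod (le_trans (f_le u) Hu).
  rewrite (reK_eq_mod e); congr (emb _); apply/eqP; rewrite eq_le f_le /=.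
  by rewrite -e.
have fv l : re (l * g) <= re (l * f v) by rewrite -fZ fG; exact: (GC _ (Cl l)).
apply/eqP; rewrite -subr_eq0 -modK_eq0; set z := _ - _.
(* The choice l = - conj(z) turns the inequality into - |z|^2 >= 0. *)
have := fv (- conjK z); rewrite -subr_ge0 -raddfB /= -mulrBr mulNr mul_conjK raddfN.
by rewrite /= embKK oppr_ge0 => hz; rewrite -sqrf_eq0 eq_le hz sqr_ge0.
Qed.

End HahnBanach.

(** * Splitting off a coordinate *)

Section LpSplitting.
Variables (R : realType) (k : scalars).
Local Notation K := (scalarK R k).
Local Notation emb := (@embK R k).
Variables (X : nat -> normedModType K) (p : R) (hp : 1 <= p).
Local Notation lp := (lp_sum X hp).
Implicit Types (x : lp) (m : nat) (c d l : K).

Lemma lp_series_dfwith (z : forall n, X n) m (y : X m) :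
  lp_series p (dfwith z m y) = ((nrm y `^ p)%:E + lp_series p (dfwith z m 0%R))%E.
Proof.
have p0 : 0 < p := lt_le_trans ltr01 hp.
have pos (w : forall n, X n) n : (0 <= (nrm (w n) `^ p)%:E)%E.
  by rewrite lee_fin powR_ge0.
have split1 (w : forall n, X n) : lp_series p w = ((nrm (w m) `^ p)%:E +
    \sum_(0 <= n <oo | n != m) (nrm (w n) `^ p)%:E)%E.
  exact: (@nneseriesD1 R (fun n => (nrm (w n) `^ p)%:E) m xpredT
    (fun n _ => pos w n) isT).
rewrite split1 [in RHS]split1 !dfwithin nrm0 powR0 ?gt_eqF// add0e.
by congr (_ + _)%E; apply: eq_eseriesr => n nm; rewrite !dfwithout 1?eq_sym.
Qed.

Definition lp_rest x m : R := fine (lp_series p (dfwith x m 0)).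

Lemma lp_series_split x m :
  lp_series p x = ((nrm (x m) `^ p)%:E + lp_series p (dfwith x m 0%R))%E.
Proof.
rewrite -lp_series_dfwith; congr lp_series.
by apply: functional_extensionality_dep => n; case: dfwithP.
Qed.

Lemma lp_restE x m : lp_series p (dfwith x m 0) = (lp_rest x m)%:E.
Proof.
rewrite fineK// ge0_fin_numE ?lp_series_ge0//.
apply: le_lt_trans (lp_coordP x); rewrite (lp_series_split x m).
by rewrite leeDr// lee_fin powR_ge0.
Qed.

Lemma lp_rest_ge0 x m : 0 <= lp_rest x m.
Proof. by rewrite -lee_fin -lp_restE lp_series_ge0. Qed.

Lemma lp_total x m : fine (lp_series p x) = nrm (x m) `^ p + lp_rest x m.
Proof. by rewrite (lp_series_split x m) lp_restE. Qed.

Lemma nrm_powR_gt0 m (y : X m) : y != 0 -> 0 < nrm y `^ p.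
Proof. by move=> y0; rewrite powR_gt0// nrm_gt0. Qed.

Lemma lp_rest_ge x m n : n != m -> nrm (x n) `^ p <= lp_rest x m.
Proof.
move=> nm; have xn : dfwith x m 0 n = x n by rewrite dfwithout// eq_sym.
have := lp_series_dfwith (dfwith x m 0) (x n).
have -> : dfwith (dfwith x m 0) n (x n) = dfwith x m 0.
  by apply: functional_extensionality_dep => j; case: dfwithP.
by rewrite lp_restE => e; rewrite -lee_fin e leeDl// lp_series_ge0.
Qed.

Lemma lp_rest_ge2 x m n j : n != m -> j != m -> j != n ->
  nrm (x n) `^ p + nrm (x j) `^ p <= lp_rest x m.
Proof.
move=> nm jm jn.
have e : dfwith (dfwith x m 0) n (x n) = dfwith x m 0.
  apply: functional_extensionality_dep => i; case: dfwithP => //.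
  by rewrite dfwithout// eq_sym.
have e2 : dfwith (dfwith (dfwith x m 0) n 0) j (x j) =
    dfwith (dfwith x m 0) n 0.
  apply: functional_extensionality_dep => i; case: dfwithP => //.
  by rewrite !dfwithout// eq_sym.
rewrite -lee_fin -lp_restE -e lp_series_dfwith -e2 lp_series_dfwith EFinD.
by rewrite leeD2l// leeDl// lp_series_ge0.
Qed.

Lemma lp_rest_eq0 x m : (forall n, n != m -> x n = 0) -> lp_rest x m = 0.
Proof.
move=> x0; rewrite /lp_rest.
have -> : dfwith x m 0 = (fun n => 0 : X n).
  apply: functional_extensionality_dep => n; case: dfwithP => // j mj.
  by rewrite x0// eq_sym.
by rewrite lp_series0.
Qed.

Lemma lp_series_graft x m (y : X m) c :
  lp_series p (dfwith (fun n => c *: x n) m y) =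
    (nrm y `^ p + lp_rest x m * modK c `^ p)%:E.
Proof.
rewrite lp_series_dfwith EFinD; congr (_ + _)%E.
have -> : dfwith (fun n => c *: x n) m 0 = (fun n => c *: dfwith x m 0 n).
  apply: functional_extensionality_dep => n; case: dfwithP => [|j mj].
    by rewrite dfwithin scaler0.
  by rewrite dfwithout.
by rewrite lp_seriesZ lp_restE muleC EFinM.
Qed.

Lemma lp_graftP x m (y : X m) c :
  (lp_series p (dfwith (fun n => c *: x n) m y) < +oo)%E.
Proof. by rewrite lp_series_graft ltry. Qed.

(* In the decomposition of the sum as [X m] and the rest, this is
   [(y, c w)], where [w] is [x] without its coordinate [m]. *)
Definition graft x m (y : X m) c : lp := LpSum hp (lp_graftP x y c).

Lemma graftD x m (u v : X m) c d l :
  graft x u c + l *: graft x v d = graft x (u + l *: v) (c + l * d).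
Proof.
apply: lp_sumP => n /=; case: dfwithP => [|j mj]; first by rewrite !dfwithin.
by rewrite !dfwithout// scalerA -scalerDl.
Qed.

Lemma graft_id x m : graft x (x m) 1 = x.
Proof. by apply: lp_sumP => n /=; case: dfwithP => // j _; rewrite scale1r. Qed.

(** The p-th root is strictly increasing, so comparing norms amounts to comparing the two-term sums
    of p-th powers to which the first-order conditions apply. *)
Lemma graft_bj_orth x m (u v : X m) c d :
  bj_orth (graft x u c) (graft x v d) <->
  forall l, nrm u `^ p + lp_rest x m * modK c `^ p
    <= nrm (u + l *: v) `^ p + lp_rest x m * modK (c + l * d) `^ p.
Proof.
have p0 : 0 < p := lt_le_trans ltr01 hp.
have normE (w : X m) (a : K) : `|graft x w a| =
    emb ((nrm w `^ p + lp_rest x m * modK a `^ p) `^ p^-1).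
  by rewrite lp_sum_normE /lp_norm lp_series_graft.
have ge0 (w : X m) (a : K) : 0 <= nrm w `^ p + lp_rest x m * modK a `^ p.
  by rewrite addr_ge0 ?mulr_ge0 ?powR_ge0 ?lp_rest_ge0.
have root_le (a b : R) : 0 <= a -> 0 <= b -> (a `^ p^-1 <= b `^ p^-1) = (a <= b).
  move=> a0 b0; have ip : 0 < p^-1 by rewrite invr_gt0.
  apply/idP/idP => [|ab]; last by rewrite ge0_ler_powR ?nnegrE// ltW.
  by rewrite !leNgt; apply: contra => ba; exact: gt0_ltr_powR.
split=> H l; have := H l; rewrite graftD !normE ler_embK.
  by rewrite (root_le _ _ (ge0 _ _) (ge0 _ _)).
by rewrite -(root_le _ _ (ge0 _ _) (ge0 _ _)).
Qed.

Lemma bj_orth_nrm (V : normedModType K) (u v : V) :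
  bj_orth u v <-> forall l, nrm u <= nrm (u + l *: v).
Proof.
split=> H l; first exact/reK_le/H.
by rewrite -!embK_nrm; apply: embK_le.
Qed.

Lemma graft_bj_orth_rest0 x m (u v : X m) c d : lp_rest x m = 0 ->
  bj_orth (graft x u c) (graft x v d) <-> bj_orth u v.
Proof.
have p0 : 0 < p := lt_le_trans ltr01 hp.
move=> r0; rewrite graft_bj_orth bj_orth_nrm r0; split=> H l; have := H l.
  rewrite !mul0r !addr0 => h; rewrite leNgt; apply/negP => h'.
  by have := gt0_ltr_powR p0 (nrm_ge0 _) (nrm_ge0 _) h'; rewrite ltNge h.
by rewrite !mul0r !addr0 => h; rewrite ge0_ler_powR ?nnegrE ?nrm_ge0// ltW.
Qed.

(** Without a rest, the second component of a graft does not affect orthogonality, so [y] is tested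
    through [graft x y 0] against [x = graft x (x m) 1]. *)
Lemma left_symmetric_coord x m : (forall n, n != m -> x n = 0) ->
  left_symmetric x -> left_symmetric (x m).
Proof.
move=> /lp_rest_eq0 r0 symx y xy.
apply/(graft_bj_orth_rest0 y (x m) 0 1 r0); rewrite (graft_id x m); apply: symx.
have e := graft_bj_orth_rest0 (x m) y 1 0 r0.
by rewrite (graft_id x m) in e; exact/e.
Qed.

Lemma right_symmetric_coord x m : (forall n, n != m -> x n = 0) ->
  right_symmetric x -> right_symmetric (x m).
Proof.
move=> /lp_rest_eq0 r0 symx y yx.
apply/(graft_bj_orth_rest0 (x m) y 1 0 r0); rewrite (graft_id x m); apply: symx.
have e := graft_bj_orth_rest0 y (x m) 0 1 r0.
by rewrite (graft_id x m) in e; exact/e.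
Qed.

End LpSplitting.

(** * Support functionals and semi-inner products *)

Section SemiInnerProducts.
Variables (R : realType) (k : scalars).
Local Notation K := (scalarK R k).
Local Notation emb := (@embK R k).
Local Notation re := (@reK R k).
Local Notation conj := (@conjK R k).
Variable V : normedModType K.
Implicit Types (u v w : V) (l : K) (f : V -> K^o) (ip : V -> V -> K).

(** A support functional at [u]. For non-zero [u] the bound by the norm stands for continuity and
    dual norm one, see [dual_normP]. *)
Definition norming f u :=
  [/\ linear f, forall v, modK (f v) <= nrm v & f u = emb (nrm u)].

Lemma norming_linear f u a v w : norming f u -> f (v + a *: w) = f v + a * f w.
Proof. by move=> [fL _ _]; rewrite addrC fL addrC. Qed.

Lemma norming_le f u v l : norming f u -> nrm u + re (l * f v) <= nrm (u + l *: v).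
Proof.
move=> fu; have [_ f_le fuE] := fu.
have -> : nrm u + re (l * f v) = re (f (u + l *: v)).
  by rewrite (norming_linear _ _ _ fu) fuE reKD embKK.
exact: le_trans (reK_le_mod _) (f_le _).
Qed.

(** Together with [norming_le] this characterises the values at [v] of the support functionals at
    [u]. *)
Lemma norming_exists u v (g : K) :
  (forall l, nrm u + re (l * g) <= nrm (u + l *: v)) ->
  exists2 f, norming f u & f v = g.
Proof. by move=> /norming_functional[f [? ? ? ?]]; exists f. Qed.

Lemma sip_norming ip u : is_sip ip -> u != 0 ->
  norming (fun v => emb (nrm u)^-1 * ip u v) u.
Proof.
move=> [ip_norm ip_lin _ ip_cs] u0; have N0 := nrm_gt0 u0; split.
- move=> a v w; rewrite [a *: v + w]addrC -ip_lin.
  by rewrite -[a *: _]/(a * _); ring.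
- move=> v; rewrite modKM modK_emb ger0_norm ?invr_ge0 ?nrm_ge0//.
  rewrite mulrC ler_pdivrMr// mulrC.
  have := ip_cs u v; rewrite !ip_norm -exprMn -modKE.
  rewrite -(embK_nrm u) -(embK_nrm v) -rmorphM /=.
  rewrite -!rmorphXn /= ler_embK.
  by rewrite ler_pXn2r// nnegrE ?modK_ge0// mulr_ge0 ?nrm_ge0.
- rewrite ip_norm -embK_nrm -rmorphXn -rmorphM /=; congr emb.
  by field; rewrite gt_eqF.
Qed.

(** The axioms relate different first arguments only by homogeneity, so [ip] can be redefined on the
    line through [u] alone; there they follow from [f] being a support functional. *)
Lemma sip_replace ip u f : is_sip ip -> u != 0 -> norming f u ->
  exists ip', is_sip ip' /\ forall v, ip' u v = emb (nrm u) * f v.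
Proof.
move=> [ip_norm ip_lin ip_homo ip_cs] u0 fu; have [fL f_le fuE] := fu.
have N0 := nrm_gt0 u0.
pose line w := exists l, w = l *: u.
(* The value 0 off the line is a default that is never read. *)
have coef w : {l | line w -> w = l *: u}.
  by apply: cid; have [[l ->]|nl] := pselect (line w); [exists l | exists 0].
pose ip' w v := if `[< line w >] then conj (sval (coef w)) * (emb (nrm u) * f v)
  else ip w v.
have ip'_line l v : ip' (l *: u) v = conj l * (emb (nrm u) * f v).
  have lu : line (l *: u) by exists l.
  rewrite /ip' asboolT//; case: (coef _) => /= m /(_ lu) e; congr (conj _ * _).
  apply/eqP; rewrite -subr_eq0; have /eqP : (m - l) *: u = 0.
    by rewrite scalerBl -e subrr.
  by rewrite scaler_eq0 (negbTE u0) orbF.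
have ip'_off w v : ~ line w -> ip' w v = ip w v.
  by move=> nl; rewrite /ip' asboolF.
have ip'_norm w : ip' w w = `|w| ^+ 2.
  have [[l ->]|nl] := pselect (line w); last by rewrite ip'_off// ip_norm.
  have fl : f (l *: u) = l * f u := GRing.scalable_linear fL l u.
  rewrite ip'_line fl fuE -embK_nrm nrm_modZ.
  have -> : conj l * (emb (nrm u) * (l * emb (nrm u))) =
    conj l * l * emb (nrm u) ^+ 2 by ring.
  by rewrite mul_conjK -!rmorphXn -rmorphM -exprMn.
exists ip'; split; last first.
  by move=> v; have := ip'_line 1 v; rewrite scale1r rmorph1 mul1r.
split=> //.
- move=> w y z l; have [[m ->]|nl] := pselect (line w); last by rewrite !ip'_off.
  rewrite !ip'_line (norming_linear _ _ _ fu); ring.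
- move=> w v l; have [[m ->]|nl] := pselect (line w).
    by rewrite scalerA !ip'_line [conj (l * m)]rmorphM -mulrA.
  (* Scaling by 0 is the one case that moves a vector from outside the line onto it. *)
  have [->|l0] := eqVneq l 0.
    have := ip'_line 0 v; rewrite !scale0r => ->.
    by rewrite [conj 0]rmorph0 !mul0r.
  rewrite !ip'_off// => -[m e]; apply: nl; exists (l^-1 * m).
  by rewrite -scalerA -e scalerA mulVf// scale1r.
- move=> w v; have [[m ->]|nl] := pselect (line w); last first.
    by rewrite !ip'_norm ip'_off// -!ip_norm.
  rewrite !ip'_norm ip'_line -exprMn -modKE -(embK_nrm (m *: u)) -(embK_nrm v).
  rewrite -!rmorphM /= -!rmorphXn /= ler_embK.
   rewrite ler_pXn2r// ?nnegrE ?modK_ge0// ?mulr_ge0 ?nrm_ge0//.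
  rewrite !modKM modK_conj modK_emb ger0_norm ?nrm_ge0// nrm_modZ mulrA.
  by rewrite ler_wpM2l// mulr_ge0 ?modK_ge0 ?nrm_ge0.
Qed.

Lemma sip_powerE p u v c : 1 < p -> u != 0 -> v != 0 ->
  sip_power p u v c = emb (nrm u * nrm v) * dualK p (emb (nrm u * nrm v)^-1 * c).
Proof.
move=> p1 u0 v0; have uv0 : nrm u * nrm v != 0.
  by rewrite gt_eqF// mulr_gt0 ?nrm_gt0.
have := fmorph_eq0 (@embK R k) (nrm u * nrm v); rewrite (negbTE uv0) => /negbT e0.
rewrite /sip_power /dualK [conj (_ * c)]rmorphM /= conjK_emb fmorphV /=.
rewrite -(embK_nrm u) -(embK_nrm v) -rmorphM /= [c / _]mulrC.
by rewrite [RHS]mulrCA (mulVKf e0).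
Qed.

(** The dual norm is exactly one because the bound is attained at u / |u|. *)
Lemma dual_normP f u : u != 0 ->
  linear f /\ continuous f /\ dual_norm f = 1%E /\ f u = `|u| <-> norming f u.
Proof.
move=> u0; split=> [[fL [_ [f1 fu]]]|[fL f_le fu]].
  have fZ l w : f (l *: w) = l * f w := GRing.scalable_linear fL l w.
  split=> //; last by rewrite fu embK_nrm.
  move=> v; have [->|v0] := eqVneq v 0.
    by have := fZ 0 0; rewrite scale0r mul0r => ->; rewrite modK0 nrm_ge0.
  have N0 := nrm_gt0 v0; have iN0 : 0 <= (nrm v)^-1 by rewrite invr_ge0 ltW.
  have : ((nrm (f (emb (nrm v)^-1 *: v) : K^o))%:E <= dual_norm f)%E.
    apply: ereal_sup_ubound; exists (emb (nrm v)^-1 *: v) => //=.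
    by rewrite -embK_nrm nrm_embZ// mulVf ?gt_eqF// rmorph1.
  rewrite f1 lee_fin fZ -[nrm _]/(modK _) modKM modK_emb ger0_norm//.
  by rewrite mulrC ler_pdivrMr// mul1r.
split=> //; split; last split; last by rewrite fu embK_nrm.
  pose fl : {linear V -> K^o} := HB.pack f (GRing.isLinear.Build K V K^o _ f fL).
  apply: (bounded_linear_continuous (f := fl)).
  apply/linear_boundedP; exists 1; split=> [|M M1 v]; first exact: real1.
  have M0 : 0 <= M := le_trans ler01 (ltW M1).
  rewrite -[fl v]/(f v) -modKE; apply: le_trans (embK_le _ (f_le v)) _.
  by rewrite embK_nrm ler_peMl// ltW.
apply/eqP; rewrite eq_le; apply/andP; split.
  apply: ge_ereal_sup => _ [v v1 <-]; rewrite lee_fin.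
  by apply: le_trans (f_le v) _; rewrite -(ler_embK k) (embK_nrm v) rmorph1.
have N0 := nrm_gt0 u0; have iN0 : 0 <= (nrm u)^-1 by rewrite invr_ge0 ltW.
apply: ereal_sup_ubound; exists (emb (nrm u)^-1 *: u) => /=.
  by rewrite -embK_nrm nrm_embZ// mulVf ?gt_eqF// rmorph1.
have -> : f (emb (nrm u)^-1 *: u) = 1.
  have -> : f (emb (nrm u)^-1 *: u) = emb (nrm u)^-1 * f u
    := GRing.scalable_linear fL _ _.
  by rewrite fu -rmorphM /= mulVf ?gt_eqF// rmorph1.
by rewrite -[nrm _]/(modK (1 : K)) modK1.
Qed.

End SemiInnerProducts.

(** * Symmetric points *)

Lemma smooth_of_unique_norming (R : realType) (k : scalars)
    (V : normedModType (scalarK R k)) (u : V) : u != 0 ->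
  (forall f g, norming f u -> norming g u -> f = g) -> smooth u.
Proof.
move=> u0 uniq_f; split=> //.
have [l|f fu _] := @norming_exists R k V u 0 0.
  by rewrite mulr0 raddf0 scaler0 !addr0.
have /(dual_normP f u0) [fL [fc [f1 fuE]]] := fu.
exists f; split=> // g [gL gc g1 guE]; apply: uniq_f => //.
by apply/(dual_normP g u0).
Qed.

(** Dividing by [s] gives s^(p-2) = 1, and for p different from 2 the exponent can be inverted. *)
Lemma powR_self_eq1 (R : realType) (p s : R) : p != 2 -> 0 < s ->
  s `^ (p - 1) = s -> s = 1.
Proof.
move=> p2 s0 e; have p20 : p - 2 != 0 by rewrite subr_eq0.
have : s `^ (p - 2) = 1.
  have -> : p - 2 = (p - 1) - 1 by ring.
  rewrite powRD; last by rewrite (gt_eqF s0) implybT.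
  by rewrite e powR_inv1 ?ltW// divff// gt_eqF.
move=> /(congr1 (fun a => a `^ (p - 2)^-1)).
by rewrite -powRrM divff// powRr1 ?ltW// powR1.
Qed.

(** The preimage is the same map for the conjugate exponent q = p / (p - 1), since q - 2 = (p -
    1)^-1 - 1. *)
Lemma dualK_surj (R : realType) (k : scalars) (p : R) (d : scalarK R k) :
  1 < p ->
  exists e : scalarK R k, dualK p e = d.
Proof.
move=> p1; have [->|d0] := eqVneq d 0; first by exists 0; exact: dualK0.
have D0 : 0 < modK d by rewrite modK_gt0.
have p10 : p - 1 != 0 by lra.
set D := modK d in D0 *; pose s := (p - 1)^-1.
exists (embK k (D `^ (s - 1)) * conjK d).
rewrite /dualK modKM modK_emb modK_conj ger0_norm ?powR_ge0// -/D.
have -> : D `^ (s - 1) * D = D `^ s.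
  rewrite -{2}(powRr1 (ltW D0)) -powRD ?subrK//.
  by rewrite (gt_eqF D0) implybT.
rewrite [conjK (_ * _)]rmorphM /= conjK_emb conjKK mulrA -rmorphM /=.
rewrite -powRrM -powRD; last by rewrite (gt_eqF D0) implybT.
have -> : s * (p - 2) + (s - 1) = 0 by rewrite /s; field.
by rewrite powRr0 rmorph1 mul1r.
Qed.

(** * Consequences of symmetry at a non-zero coordinate *)

Section Symmetry.
Variables (R : realType) (k : scalars).
Local Notation K := (scalarK R k).
Local Notation emb := (@embK R k).
Local Notation re := (@reK R k).
Variables (X : nat -> normedModType K) (p : R) (p_gt1 : 1 < p).
Variables (x : lp_sum X (ltW p_gt1)) (m : nat).
Hypothesis xm0 : x m != 0.
Local Notation r := (nrm (x m)).
Local Notation B := (lp_rest x m).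
Local Notation dual := (@dualK R k p).

Let r0 : 0 < r. Proof. exact: nrm_gt0. Qed.

Lemma dualK1 : dual 1 = 1.
Proof.
by have := @dualK_emb R k p p_gt1 1 ler01; rewrite powR1 rmorph1.
Qed.

Lemma graft_axis_orth (a b : R) (c d : K) : 0 < a ->
  emb (r `^ p * a `^ (p - 1) * b) + emb B * (dual c * d) = 0 ->
  bj_orth (graft x (emb a *: x m) c) (graft x (emb b *: x m) d).
Proof.
move=> a0 e; apply/graft_bj_orth; have ar0 : 0 <= a * r by rewrite mulr_ge0 ?ltW.
apply: (@power_sum_min R k p p_gt1 _ _ _ _ _ _ (emb (b * r))).
- exact: lp_rest_ge0.
- move=> l; rewrite (nrm_embZ _ (ltW a0)) scalerA -scalerDl nrm_modZ.
  have -> : a * r + re (l * emb (b * r)) = re (emb a + l * emb b) * r.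
    rewrite reKD embKK mulrDl; congr (_ + _).
    by rewrite rmorphM /= mulrA mulrC reK_embM mulrC.
  by rewrite (ler_wpM2r (ltW r0)) ?reK_le_mod.
- rewrite -[RHS]e; congr (_ + _); rewrite -rmorphM /=; congr emb.
  rewrite (nrm_embZ _ (ltW a0)) (powRM _ (ltW a0) (ltW r0)).
  by rewrite (powR_mulB1 p_gt1 (ltW r0)); ring.
Qed.

(** Along the axis of [x m] the norm is affine while a + t b >= 0, so small steps of either sign are
    allowed and the first-order inequality becomes an equality. *)
Lemma graft_axis_orth_inv (a b : R) (c d : K) : 0 < a -> 0 < b ->
  bj_orth (graft x (emb a *: x m) c) (graft x (emb b *: x m) d) ->
  r `^ p * a `^ (p - 1) * b + B * re (dual c * d) = 0.
Proof.
move=> a0 b0 /graft_bj_orth H.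
have ax0 : emb a *: x m != 0.
  by rewrite scaler_eq0 negb_or xm0 andbT fmorph_eq0 gt_eqF.
have ineq (t : R) : 0 <= a + t * b ->
    0 <= t * (r `^ p * a `^ (p - 1) * b + B * re (dual c * d)).
  move=> t0.
  have := power_sum_derivative_ge0 p_gt1 ax0 (lp_rest_ge0 x m) H (emb t).
  rewrite scalerA -scalerDl -rmorphM -rmorphD /= !nrm_embZ ?(ltW a0)//.
  rewrite [dual c * _]mulrCA reK_embM (powRM _ (ltW a0) (ltW r0)).
  rewrite (powR_mulB1 p_gt1 (ltW r0)); move=> h; apply: le_trans h _.
  rewrite le_eqVlt; apply/orP; left; apply/eqP; ring.
(* The steps are t = a / b and t = - a / b; the second just reaches a + t b = 0. *)
have s1 : 0 <= a + a / b * b by rewrite divfK ?gt_eqF// addr_ge0 ?(ltW a0).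
have s2 : 0 <= a + - (a / b) * b by rewrite mulNr divfK ?gt_eqF// subrr.
have h1 := ineq _ s1; have := ineq _ s2; rewrite mulNr oppr_ge0 => h2.
have ab0 : a / b != 0 by rewrite gt_eqF ?divr_gt0.
apply/eqP.
have : a / b * (r `^ p * a `^ (p - 1) * b + B * re (dual c * d)) == 0.
  by rewrite eq_le h1 h2.
by rewrite mulf_eq0 (negbTE ab0).
Qed.

Lemma graft_axis_id : graft x (emb 1 *: x m) 1 = x.
Proof. by rewrite rmorph1 scale1r graft_id. Qed.

Lemma lp_rest_left_symmetric : p != 2 -> 0 < B -> left_symmetric x -> B = r `^ p.
Proof.
move=> p2 B0 symx; set A := r `^ p; have A0 : 0 < A by rewrite powR_gt0.
(* The pair (B, -A) annihilates the gradient (A, B) at x = (1, 1). The reversed relation reads A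
   B^(p-1) = B A^(p-1), that is s^(p-1) = s for s = B / A. *)
have /symx : bj_orth x (graft x (emb B *: x m) (- emb A)).
  rewrite -[X in bj_orth X]graft_axis_id; apply: graft_axis_orth => //.
  by rewrite powR1 mulr1 dualK1 mul1r rmorphM /=; ring.
rewrite -[X in bj_orth _ X]graft_axis_id => /(graft_axis_orth_inv B0 ltr01).
rewrite -/A mulr1 mulr1 dualKN dualK_emb ?(ltW A0)// -rmorphN /= embKK => e.
have s0 : 0 < B / A by rewrite divr_gt0.
have BE : B = B / A * A by rewrite divfK ?gt_eqF.
suff s1 : B / A = 1 by rewrite BE s1 mul1r.
apply: (powR_self_eq1 p2 s0).
have AA : A * A `^ (p - 1) != 0 by rewrite gt_eqF// mulr_gt0 ?powR_gt0.
apply: (mulIf AA); move: e; rewrite [in B `^ _]BE powRM ?(ltW s0) ?(ltW A0)// => e.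
rewrite mulrCA [RHS]mulrA divfK ?gt_eqF//; lra.
Qed.

Lemma lp_rest_right_symmetric : p != 2 -> 0 < B -> right_symmetric x -> B = r `^ p.
Proof.
move=> p2 B0 symx; set A := r `^ p; have A0 : 0 < A by rewrite powR_gt0.
have s0 : 0 < B / A by rewrite divr_gt0.
have p1 := p_gt1; have p10 : p - 1 != 0 by lra.
(* Chosen so that A a^(p-1) = B, which makes (a, -1) orthogonal to x = (1, 1). The reversed relation
   is A a = B, hence a^(p-1) = a. *)
pose a := (B / A) `^ (p - 1)^-1; have a0 : 0 < a by rewrite powR_gt0.
have aE : a `^ (p - 1) = B / A by rewrite /a -powRrM mulVf// powRr1// ltW.
have /symx : bj_orth (graft x (emb a *: x m) (- 1)) x.
  rewrite -[X in bj_orth _ X]graft_axis_id; apply: graft_axis_orth => //.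
  rewrite aE mulr1 dualKN dualK1 -/A mulrCA divff ?gt_eqF// mulr1.
  by rewrite mulr1 mulrN1 subrr.
rewrite -[X in bj_orth X]graft_axis_id => /(graft_axis_orth_inv ltr01 a0).
rewrite -/A powR1 mulr1 dualK1 mul1r -(rmorphN1 emb) embKK => e.
have Aa : A * a = B by lra.
have A_neq0 : A != 0 by rewrite gt_eqF.
have a_s : a = B / A by apply: (mulfI A_neq0); rewrite Aa mulrC divfK.
have a1 : a = 1 by apply: (powR_self_eq1 p2 a0); rewrite aE.
by rewrite -Aa a1 mulr1.
Qed.

(** By [norming_exists] the conclusion provides a support functional at [y] with this value at
    [x m]. *)
Lemma left_symmetric_norming (f : X m -> K^o) (y : X m) :
  B = r `^ p -> left_symmetric x -> norming f (x m) -> y != 0 ->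
  forall l, nrm y + re (l * (emb (r / nrm y `^ (p - 1)) * dual (f y)))
    <= nrm (y + l *: x m).
Proof.
move=> BE symx fx y0 l; have N0 := nrm_gt0 y0.
have rN0 : r != 0 by rewrite gt_eqF.
(* This solves r^(p-1) f(y) + r^p b = 0, the vanishing of the gradient at [x] in the direction (y,
   b). *)
pose b : K := - (emb r^-1 * f y).
have /symx : bj_orth x (graft x y b).
  rewrite -[X in bj_orth X](graft_id x m); apply/graft_bj_orth.
  apply: (@power_sum_min R k p p_gt1 _ _ _ _ _ _ (f y)).
  - exact: lp_rest_ge0.
  - by move=> h; exact: norming_le.
  - rewrite dualK1 mul1r BE (powR_mulB1 p_gt1 (ltW r0)) /b mulrN mulrA -rmorphM /=.
    by rewrite mulrAC divff// mul1r subrr.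
rewrite -[X in bj_orth _ X](graft_id x m) => /graft_bj_orth H.
have := power_sum_derivative_ge0 p_gt1 y0 (lp_rest_ge0 x m) H l.
have NN0 : 0 < nrm y `^ (p - 1) by rewrite powR_gt0.
rewrite mulr1 /b dualKN dualKM dualK_emb ?invr_ge0 ?(ltW r0)// BE.
have -> : - (emb (r^-1 `^ (p - 1)) * dual (f y)) * l =
  emb (- (r^-1 `^ (p - 1))) * (l * dual (f y)) by rewrite rmorphN /=; ring.
have -> : l * (emb (r / nrm y `^ (p - 1)) * dual (f y)) =
  emb (r / nrm y `^ (p - 1)) * (l * dual (f y)) by ring.
rewrite !reK_embM (powR_mulB1 p_gt1 (ltW r0)) => h.
rewrite addrC -lerBrDr mulrAC ler_pdivrMr// mulrC -subr_ge0.
have e : r `^ (p - 1) * r^-1 `^ (p - 1) = 1.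
  by rewrite -powRM ?invr_ge0 ?(ltW r0)// divff// powR1.
apply: le_trans h _; rewrite le_eqVlt; apply/orP; left; apply/eqP.
have -> : r * r `^ (p - 1) * (- r^-1 `^ (p - 1) * re (l * dual (f y))) =
  - (r `^ (p - 1) * r^-1 `^ (p - 1)) * (r * re (l * dual (f y))) by ring.
by rewrite e; ring.
Qed.

Lemma left_symmetric_sip : B = r `^ p -> left_symmetric x ->
  left_sip_symmetric p (x m).
Proof.
move=> BE symx y y0 ip ipP; have N0 := nrm_gt0 y0.
have fx := sip_norming ipP xm0; set f := fun v => _ in fx.
have [g gy gE] := norming_exists (left_symmetric_norming BE symx fx y0).
have [ip' [ip'P ip'y]] := sip_replace ipP y0 gy.
exists ip'; split=> //; rewrite ip'y gE sip_powerE// /f.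
have NN0 : 0 < nrm y `^ (p - 1) by rewrite powR_gt0.
have -> : emb (r * nrm y)^-1 * ip (x m) y =
    emb (nrm y)^-1 * (emb r^-1 * ip (x m) y).
  by rewrite invfM rmorphM /=; ring.
have iN0 : 0 <= (nrm y)^-1 by rewrite invr_ge0 ltW.
rewrite (dualKM p (emb (nrm y)^-1)) (dualK_emb k p_gt1 iN0).
move: (dual (emb r^-1 * _)) => D; rewrite !mulrA -!rmorphM /=.
congr (emb _ * _); have e : nrm y `^ (p - 1) * (nrm y)^-1 `^ (p - 1) = 1.
  by rewrite -powRM ?(ltW N0)// divff ?gt_eqF// powR1.
have NN : nrm y `^ (p - 1) != 0 by rewrite gt_eqF.
apply: (mulIf NN); rewrite -[RHS]mulrA [(nrm y)^-1 `^ _ * _]mulrC e.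
by field; rewrite NN.
Qed.

Lemma left_symmetric_smooth : B = r `^ p -> left_symmetric x -> smooth (x m).
Proof.
move=> BE symx; apply: smooth_of_unique_norming => // f f' fx f'x.
apply/funext => y; apply/eqP; rewrite -subr_eq0; apply/negPn/negP => fy.
have [fL _ fxE] := fx; have [f'L _ f'xE] := f'x.
have er0 : emb r != 0 by rewrite fmorph_eq0 gt_eqF.
(* Subtracting a multiple of [x m] puts [z] in the kernel of [f']; rescaling then gives f w = -1. *)
pose z := y + (- (f' y / emb r)) *: x m.
pose w := (- (f y - f' y)^-1) *: z.
have f'z : f' z = 0.
  by rewrite (norming_linear _ _ _ f'x) f'xE mulNr divfK// subrr.
have fz : f z = f y - f' y.
  by rewrite (norming_linear _ _ _ fx) fxE mulNr divfK.
have f'w : f' w = 0.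
  have -> : f' w = - (f y - f' y)^-1 * f' z := GRing.scalable_linear f'L _ _.
  by rewrite f'z mulr0.
have fw : f w = -1.
  have -> : f w = - (f y - f' y)^-1 * f z := GRing.scalable_linear fL _ _.
  by rewrite fz mulNr mulVf.
(* Half of 1 / r, so that [f] is still negative, equal to -1/2, at w + t x m. *)
pose t := (r *+ 2)^-1; have t0 : 0 < t by rewrite invr_gt0 pmulrn_lgt0.
have f0 : f 0 = 0.
  have : f (0 *: 0) = 0 * f 0 := GRing.scalable_linear fL _ _.
  by rewrite scale0r mul0r.
have w0 : w != 0.
  apply/eqP => e; move: fw; rewrite e f0 => /eqP.
  by rewrite eq_sym oppr_eq0 oner_eq0.
have fw' : f (w + emb t *: x m) = - emb 2^-1.
  rewrite (norming_linear _ _ _ fx) fw fxE -rmorphM /= /t.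
  have -> : (r *+ 2)^-1 * r = 1 - 2^-1 by field; rewrite gt_eqF.
  by rewrite rmorphB /= rmorph1; ring.
have w'0 : w + emb t *: x m != 0.
  apply/eqP => e; move: fw'; rewrite e f0 => /eqP.
  by rewrite eq_sym oppr_eq0 fmorph_eq0 invr_eq0 pnatr_eq0.
(* The bound for [f'] at [w] gives |w| <= |w + t x m|, while the bound for [f] at w + t x m, moving
   back by [t], gives the strict opposite. *)
have h1 := left_symmetric_norming BE symx f'x w0 (emb t).
have h2 := left_symmetric_norming BE symx fx w'0 (- emb t).
move: h1; rewrite f'w dualK0 !mulr0 raddf0 addr0 => h1.
move: h2; rewrite scaleNr addrK fw' dualKN (dualK_emb k p_gt1) ?invr_ge0 ?ler0n//.
set N := nrm (w + _) in h1 *.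
rewrite mulrN mulrNN -!rmorphM /= embKK => h2.
have : 0 < t * (r / N `^ (p - 1) * 2^-1 `^ (p - 1)).
  rewrite !mulr_gt0 ?invr_gt0 ?powR_gt0 ?invr_gt0 ?nrm_gt0 //.
  by rewrite pmulrn_lgt0.
by lra.
Qed.

Lemma right_symmetric_sip : B = r `^ p -> right_symmetric x ->
  right_sip_symmetric p (x m).
Proof.
move=> BE symx y y0 ip ipP; have N0 := nrm_gt0 y0; set N := nrm y in N0.
have hy := sip_norming ipP y0; set h := fun v => _ in hy.
(* With dual(e) = h(x m) / r, the component c = - (N / r) e makes N^(p-1) h(x m) + r^p dual(c)
   vanish, so (y, c) is orthogonal to [x]. The reversed relation then admits N e as the value at [y]
   of a support functional at [x m]. *)
have [e eE] := dualK_surj (emb r^-1 * h (x m)) p_gt1.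
have Nr : 0 <= N / r by rewrite divr_ge0 ?ltW.
have /symx : bj_orth (graft x y (- (emb (N / r) * e))) x.
  rewrite -[X in bj_orth _ X](graft_id x m); apply/graft_bj_orth.
  apply: (@power_sum_min R k p p_gt1 _ _ _ _ _ _ (h (x m))).
  - exact: lp_rest_ge0.
  - by move=> l; exact: norming_le.
  - rewrite mulr1 dualKN dualKM eE (dualK_emb k p_gt1 Nr) BE -/N.
    move: (h (x m)) => H; rewrite mulrN !mulrA -!rmorphM /=.
    have -> : r `^ p * (N / r) `^ (p - 1) * r^-1 = N `^ (p - 1).
      have E : r `^ (p - 1) * (N / r) `^ (p - 1) = N `^ (p - 1).
        by rewrite -powRM ?(ltW r0)// mulrC divfK ?gt_eqF.
      by rewrite (powR_mulB1 p_gt1 (ltW r0)) -E; field; rewrite gt_eqF.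
    by rewrite subrr.
rewrite -[X in bj_orth X](graft_id x m) => /graft_bj_orth H.
have [f fx fE] : exists2 f : X m -> K^o, norming f (x m) & f y = emb N * e.
  apply: norming_exists => l.
  have := power_sum_derivative_ge0 p_gt1 xm0 (lp_rest_ge0 x m) H l.
  rewrite dualK1 mul1r BE.
  have -> : l * - (emb (N / r) * e) = emb (- (N / r)) * (l * e).
    by rewrite rmorphN /=; ring.
  have -> : l * (emb N * e) = emb N * (l * e) by ring.
  rewrite !reK_embM (powR_mulB1 p_gt1 (ltW r0)).
  have -> : r * r `^ (p - 1) * (- (N / r) * re (l * e)) =
     r `^ (p - 1) * - (N * re (l * e)) by field; rewrite gt_eqF.
  by rewrite -mulrDr pmulr_rge0 ?powR_gt0// subr_ge0 lerBrDl.
have [ip' [ip'P ip'x]] := sip_replace ipP xm0 fx.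
exists ip'; split=> //; rewrite ip'x fE sip_powerE// -/N.
have -> : emb (r * N)^-1 * (emb r * (emb N * e)) = e.
  have -> : emb (r * N)^-1 * (emb r * (emb N * e)) = emb ((r * N)^-1 * r * N) * e.
    by rewrite !rmorphM /=; ring.
  have -> : (r * N)^-1 * r * N = 1 by field; rewrite !gt_eqF.
  by rewrite rmorph1 mul1r.
rewrite eE /h mulrA -rmorphM /= mulrA -rmorphM /=.
have -> : r * N / r / nrm y = 1 by rewrite -/N; field; rewrite !gt_eqF.
by rewrite rmorph1 mul1r.
Qed.

End Symmetry.

Lemma lp_two_coordinates (R : realType) (k : scalars)
    (X : nat -> normedModType (scalarK R k)) (p : R) (p_ge1 : 1 <= p)
    (x : lp_sum X p_ge1) :
  (forall m, x m != 0 -> 0 < lp_rest x m -> lp_rest x m = nrm (x m) `^ p) ->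
  (exists m, forall n, n != m -> x n = 0) \/
  exists m j, [/\ m != j, forall n, n != m -> n != j -> x n = 0,
    nrm (x m) = nrm (x j) & [/\ x m != 0, x j != 0,
    lp_rest x m = nrm (x m) `^ p & lp_rest x j = nrm (x j) `^ p]].
Proof.
move=> balance; have p0 : 0 < p := lt_le_trans ltr01 p_ge1.
have [x0|] := pselect (forall n, x n = 0); first by left; exists 0%N => n _.
move=> /existsNP[m /eqP xm0].
have [one|] := pselect (forall n, n != m -> x n = 0); first by left; exists m.
move=> /existsNP[j /not_implyP[jm /eqP xj0]]; right; exists m, j.
have mj : m != j by rewrite eq_sym.
have Am := nrm_powR_gt0 p xm0; have Aj := nrm_powR_gt0 p xj0.
have Bm := balance m xm0 (lt_le_trans Aj (lp_rest_ge x jm)).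
have Bj := balance j xj0 (lt_le_trans Am (lp_rest_ge x mj)).
(* The total sum is twice either p-th power. A third non-zero coordinate would push the rest at [m]
   above the p-th power at [j]. *)
have A_eq : nrm (x m) `^ p = nrm (x j) `^ p.
  by have := lp_total x m; rewrite (lp_total x j) Bm Bj; lra.
split=> //.
  move=> n nm nj; apply/eqP/negPn/negP => xn0.
  have := lp_rest_ge2 x jm nm nj; have := nrm_powR_gt0 p xn0.
  by rewrite Bm A_eq; lra.
have := congr1 (fun a => a `^ p^-1) A_eq.
by rewrite -!powRrM divff ?gt_eqF// !powRr1 ?nrm_ge0.
Qed.

Theorem theorem25 (R : realType) (F : scalars)
  (X : nat -> normedModType (scalarK R F))
  (X_nontrivial : forall n, nontrivial (X n))
  (p : R) (p_gt1 : 1 < p) (p_neq2 : p != 2)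
  (x : lp_sum X (ltW p_gt1)) :
  (left_symmetric x ->
    (exists n0 : nat,
      (forall n : nat, n != n0 -> x n = 0) /\ left_symmetric (x n0)) \/
    (exists m k : nat,
      [/\ m != k,
          forall n : nat, n != m -> n != k -> x n = 0,
          `|x m| = `|x k|,
          smooth (x m) /\ left_sip_symmetric p (x m)
        & smooth (x k) /\ left_sip_symmetric p (x k)])) /\
  (right_symmetric x ->
    (exists n0 : nat,
      (forall n : nat, n != n0 -> x n = 0) /\ right_symmetric (x n0)) \/
    (exists m k : nat,
      [/\ m != k,
          forall n : nat, n != m -> n != k -> x n = 0,
          `|x m| = `|x k|,
          right_sip_symmetric p (x m)
        & right_sip_symmetric p (x k)])).
Proof.
have norm_eq m j : nrm (x m) = nrm (x j) -> `|x m| = `|x j|.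
  by rewrite -!embK_nrm => ->.
split=> symx.
  have [|[m only_m]|[m [j [mj only xmj [xm0 xj0 Bm Bj]]]]] :=
    @lp_two_coordinates _ _ _ _ _ x.
  - by move=> m xm0 Bm; exact: lp_rest_left_symmetric.
  - by left; exists m; split=> //; exact: left_symmetric_coord.
  - right; exists m, j; split=> //; first exact: norm_eq.
      by split; [exact: left_symmetric_smooth | exact: left_symmetric_sip].
    by split; [exact: left_symmetric_smooth | exact: left_symmetric_sip].
have [|[m only_m]|[m [j [mj only xmj [xm0 xj0 Bm Bj]]]]] :=
    @lp_two_coordinates _ _ _ _ _ x.
- by move=> m xm0 Bm; exact: lp_rest_right_symmetric.
- by left; exists m; split=> //; exact: right_symmetric_coord.
- right; exists m, j; split=> //; [exact: norm_eq | exact: right_symmetric_sip |].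
  exact: right_symmetric_sip.
Qed.
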